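(* For all integers $\ell\ge 1$, we have $c_{1,2\ell+1}=c_{1,2\ell}=\frac{2\pi\ell}{2\ell+1}$, where for integers $k\ge n$ we set $c_{n,k}=\inf\{r\ge 0\mid \text{there exists an odd map } S^k\to \mathrm{VR}(S^n;r)\}$.
   Context: $S^n=\{x\in\mathbb{R}^{n+1}\mid \|x\|=1\}$ carries the geodesic metric $d_{S^n}(x,x')=\arccos\langle x,x'\rangle$, with involution $x\mapsto -x$. A ''map'' is a continuous function. A map between spaces with involutions (both written $x\mapsto -x$) is odd if $f(-x)=-f(x)$ for all $x$. For a metric space $X$ and $r\ge 0$, the Vietoris--Rips complex $\mathrm{VR}(X;r)$ is the simplicial complex with vertex set $X$ whose simplices are the nonempty finite subsets $\sigma\subseteq X$ with $\operatorname{diam}(\sigma)\le r$; it is identified with its geometric realization. If $X$ has an isometric involution $x\mapsto -x$, then $\mathrm{VR}(X;r)$ has the involution $-\left(\sum_i\lambda_i x_i\right)=\sum_i\lambda_i(-x_i)$. *)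

(* Defs.v *)
From HB Require Import structures.
From mathcomp Require Import all_boot all_order all_algebra.
From mathcomp Require Import all_classical all_reals all_analysis.

Set Implicit Arguments.
Unset Strict Implicit.
Unset Printing Implicit Defensive.

Import Order.TTheory GRing.Theory Num.Theory.
Import numFieldNormedType.Exports.

Local Open Scope classical_set_scope.
Local Open Scope ring_scope.

Record simplicial_complex (X : Type) := SimplicialComplex {
  simplex : set (set X);
  simplex_finite : forall s, simplex s -> finite_set s;
  simplex_nonempty : forall s, simplex s -> s !=set0;
  simplex_face : forall s t, simplex s -> t `<=` s -> t !=set0 -> simplex t
}.

(* A point \sum_i lambda_i x_i of the geometric realization is given by its
   barycentric coordinates, i.e., by the function mapping the vertex x_i to
   lambda_i and all other vertices to 0. *)
Record realization (R : realType) (X : choiceType) (K : simplicial_complex X) :=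
  Realization {
    coord :> X -> R;
    coord_ge0 : forall x, 0 <= coord x;
    coord_supp : simplex K [set x | coord x != 0];
    coord_sum1 : \sum_(x \in [set: X]) coord x = 1
  }.

Lemma realization_eq (R : realType) (X : choiceType) (K : simplicial_complex X)
  (p q : realization R K) : coord p =1 coord q -> p = q.
Proof.
case: p q => [p p0 pK p1] [q q0 qK q1] /= /funext pq.
by subst q; congr Realization; exact: Prop_irrelevance.
Qed.

Section realization_topology.
Context (R : realType) (X : choiceType) (K : simplicial_complex X).

HB.instance Definition _ := gen_eqMixin (realization R K).
HB.instance Definition _ := gen_choiceMixin (realization R K).

Definition closed_simplex (s : set X) : set (realization R K) :=
  [set p | forall x, ~ s x -> p x = 0].

(* The weak topology: U is open iff U `&` closed_simplex s is open in
   closed_simplex s for every simplex s, where closed_simplex s has the topology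
   of R^s. As s is finite, the latter is the topology of the sup distance. *)
Definition realization_open (U : set (realization R K)) : Prop :=
  forall s, simplex K s -> forall p, closed_simplex s p -> U p ->
    exists2 e : R, 0 < e & forall q, closed_simplex s q ->
      (forall x, s x -> `|p x - q x| < e) -> U q.

Let realization_openT : realization_open setT.
Proof. by move=> s _ p _ _; exists 1. Qed.

Let realization_openI (U V : set (realization R K)) :
  realization_open U -> realization_open V -> realization_open (U `&` V).
Proof.
move=> oU oV s Ks p sp [Up Vp].
have [e e0 eU] := oU s Ks p sp Up.
have [f f0 fV] := oV s Ks p sp Vp.
exists (Num.min e f); first by rewrite lt_min e0 f0.
move=> q sq pq; split.
  by apply: eU => // x sx; have := pq x sx; rewrite lt_min => /andP[].
by apply: fV => // x sx; have := pq x sx; rewrite lt_min => /andP[].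
Qed.

Let realization_open_bigU (I : Type) (F : I -> set (realization R K)) :
  (forall i, realization_open (F i)) -> realization_open (\bigcup_i F i).
Proof.
move=> oF s Ks p sp [i _ Fip]; have [e e0 eF] := oF i s Ks p sp Fip.
by exists e => // q sq pq; exists i => //; exact: eF.
Qed.

HB.instance Definition _ := isOpenTopological.Build (realization R K)
  realization_openT realization_openI realization_open_bigU.

End realization_topology.

Section realization_involution.
Context (R : realType) (X : choiceType) (K : simplicial_complex X).
Context (nu : X -> X) (nuK : involutive nu)
  (nuS : forall s, simplex K s -> simplex K (nu @` s)).

Let supp_nu (p : realization R K) :
  simplex K [set x | p (nu x) != 0].
Proof.
suff -> : [set x | p (nu x) != 0] = nu @` [set x | p x != 0].
  exact/nuS/coord_supp.
apply/seteqP; split => [x /= px|_ [x /= px <-]]; last by rewrite /= nuK.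
by exists (nu x).
Qed.

Let sum_nu (p : realization R K) : \sum_(x \in [set: X]) p (nu x) = 1.
Proof.
rewrite -(coord_sum1 p); apply/esym/reindex_fsbigT.
by exists nu.
Qed.

(* The coordinate of \sum_i lambda_i (nu x_i) at x is that of
   \sum_i lambda_i x_i at nu x, since nu is an involution. *)
Definition realization_inv (p : realization R K) : realization R K :=
  Realization (fun x => coord_ge0 p (nu x)) (supp_nu p) (sum_nu p).

Lemma realization_invK : involutive realization_inv.
Proof. by move=> p; apply: realization_eq => x /=; rewrite nuK. Qed.

End realization_involution.

Section vietoris_rips.
Context (R : realType) (X : Type) (d : X -> X -> R).

Definition diam (s : set X) : R := sup [set d x.1 x.2 | x in s `*` s].

Let distances_ub (s : set X) : finite_set s ->
  has_ubound [set d x.1 x.2 | x in s `*` s].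
Proof.
move=> sfin; have /finite_compact/compact_bounded : finite_set
    [set (d x.1 x.2 : R^o) | x in s `*` s].
  by apply: finite_image; exact: finite_setX.
move=> [M [_ sM]]; exists (M + 1) => z sz.
by apply: le_trans (ler_norm _) _; apply: sM => //; rewrite ltrDl.
Qed.

Let VR_face (r : R) (s t : set X) :
  [/\ finite_set s, s !=set0 & diam s <= r] -> t `<=` s -> t !=set0 ->
  [/\ finite_set t, t !=set0 & diam t <= r].
Proof.
move=> [sfin _ sr] ts [x tx]; split; first exact: sub_finite_set sfin.
  by exists x.
apply: le_trans sr; apply: ge_sup; first by exists (d x x), (x, x).
move=> _ [[y z] [/= ty tz] <-]; apply: ub_le_sup; first exact: distances_ub.
by exists (y, z) => //; split; exact: ts.
Qed.

Definition VR (r : R) : simplicial_complex X :=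
  @SimplicialComplex X
    [set s | [/\ finite_set s, s !=set0 & diam s <= r]]
    (fun s '(And3 sfin _ _) => sfin)
    (fun s '(And3 _ sn0 _) => sn0)
    (@VR_face r).

Lemma VR_isometry (nu : X -> X) (r : R) (s : set X) :
  (forall x y, d (nu x) (nu y) = d x y) -> 
  simplex (VR r) s -> simplex (VR r) (nu @` s).
Proof.
move=> nud [sfin [x sx] sr]; split; first exact: finite_image.
  by exists (nu x), x.
apply: le_trans sr; rewrite /diam le_eqVlt; apply/orP; left; apply/eqP.
congr (sup _); apply/seteqP; split.
  move=> _ [[_ _] [/= [y sy <-] [z sz <-]] <-].
  by exists (y, z) => //=; rewrite nud.
move=> _ [[y z] [/= sy sz] <-]; exists (nu y, nu z); last by rewrite /= nud.
by split; [exists y|exists z].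
Qed.

End vietoris_rips.

Section sphere.
Context (R : realType) (n : nat).

(* The norm `|x| of the library on 'rV[R]_n is the sup norm. *)
Definition inner (x y : 'rV[R]_n.+1) : R := \sum_i x 0 i * y 0 i.

Definition eucl_norm (x : 'rV[R]_n.+1) : R := Num.sqrt (inner x x).

(* As a type, sphere carries the subspace topology (of set_type). *)
Definition sphere : set 'rV[R]_n.+1 := [set x | eucl_norm x = 1].

Lemma innerNN (x y : 'rV[R]_n.+1) : inner (- x) (- y) = inner x y.
Proof. by apply: eq_bigr => i _; rewrite !mxE mulrNN. Qed.

Let sphereN (x : sphere) : - val x \in sphere.
Proof.
by rewrite inE /sphere/= /eucl_norm innerNN; exact: set_mem (valP x).
Qed.

Definition antipode (x : sphere) : sphere := exist _ (- val x) (sphereN x).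

Lemma antipodeK : involutive antipode.
Proof. by move=> x; apply: val_inj; rewrite /= opprK. Qed.

Definition geodesic (x y : sphere) : R := acos (inner (val x) (val y)).

Lemma geodesicNN (x y : sphere) :
  geodesic (antipode x) (antipode y) = geodesic x y.
Proof. by rewrite /geodesic /= innerNN. Qed.

End sphere.
Arguments sphere : clear implicits.
Arguments antipode {R n}.
Arguments geodesic {R n}.

Definition VR_sphere (R : realType) (n : nat) (r : R) :
  simplicial_complex (sphere R n) := VR geodesic r.

Definition VR_antipode (R : realType) (n : nat) (r : R) :
    realization R (VR_sphere n r) -> realization R (VR_sphere n r) :=
  realization_inv (@antipodeK R n)
    (fun s => VR_isometry (s := s) (@geodesicNN R n)).

Definition odd_map (X Y : topologicalType) (nuX : X -> X) (nuY : Y -> Y)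
    (f : X -> Y) : Prop :=
  continuous f /\ forall x, f (nuX x) = nuY (f x).

(* The set is bounded below by 0; it contains pi, as the midpoint of x and - x
   is a fixed point of the involution on VR(S^n; pi). Hence inf does not take
   its default value here. *)
Definition c (R : realType) (n k : nat) : R :=
  inf [set r : R | 0 <= r /\
    exists f : sphere R k -> realization R (VR_sphere n r),
      odd_map antipode (@VR_antipode R n r) f].

(* Main.v *)
Require Import Defs.
From mathcomp Require Import all_boot all_order all_algebra.
From mathcomp Require Import all_classical all_reals all_analysis.
From mathcomp Require Import ring lra zify.

Set Implicit Arguments.
Unset Strict Implicit.
Unset Printing Implicit Defensive.

Import Order.TTheory GRing.Theory Num.Theory.
Import numFieldNormedType.Exports.

Local Open Scope classical_set_scope.
Local Open Scope ring_scope.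

(** The value is the one at which two estimates for binary forms meet. A form of
odd degree [n], restricted to the circle, is an odd function
[f a = \sum_i c_i * cos a ^+ (n - i) * sin a ^+ i]. If nonzero, it has at most [n]
zeros in a half circle; and a product of [n] linear forms changes its sign exactly
at prescribed points there.

Lower bound. Let [m = 2 * l - 1]. The [m + 1] monomials of degree [m], extended
affinely, define an odd continuous map from the complex [VR(S^1; r)] to the
space of dimension [2 * l] ([moment]). If [r < 2 * pi * l / (2 * l + 1)], this
map has no zero: the vertices [x] of a simplex are then at distance more than
[pi / (2 * l + 1)] from all the antipodes [- y], so on a half circle, where each
line through the origin is met once, the sign which says whether [x] or [- x]
belongs to the simplex changes at most [2 * l - 1] times. A product of
[m] linear forms that vanish at these changes is positive on the simplex
([ex_positive_form], [VR_circle_positive]). An odd map from the sphere of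
dimension [k >= 2 * l] would then contradict the Borsuk--Ulam theorem
([odd_map_lower_bound]).

Borsuk--Ulam. A continuous odd family without common zero labels the points near
an octahedral sphere by signed coordinates in such a way that close points never
have opposite labels. Tucker's lemma ([tucker]) excludes this. Its proof is Fan's
parity argument, carried out on cochains mod 2: if [A] is the cochain counting
the alternating simplices of an iterated barycentric subdivision, its coboundary
is [A] plus the antipode of [A], so that the number of alternating top
simplices of an octahedral sphere has the same parity in all dimensions, and it
is odd in dimension [-1] ([octahedron_index]). Barycentric subdivision acts on
cochains as the transpose of the subdivision of affine chains, hence no
triangulation of the sphere is needed.

Upper bound. Let [n = 2 * l + 1] and [k <= n]. A point of the sphere of dimension
[k] is the coefficient vector of a nonzero form [f] of degree [n]. It is sent to
the probability measure on a fine antipodally symmetric grid whose weight at [x]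
is the positive part of [f x - kappa * max f], with [kappa < 1] close to [1]. This
is odd and continuous. If [x] and [y] lie in the support, then [f] is nearly
maximal at [x] and nearly minimal at [- y], and a form of degree [n] needs almost
[pi / n] to descend from its maximum to its minimum, as does [cos (n * a)]: if it
were faster, its difference with a shift of a multiple of [cos (n * a)] would
have too many zeros ([form_oscillation]). So [x] and [y] are at distance at most
[r] as soon as [r > pi - pi / n = 2 * pi * l / (2 * l + 1)]
([ex_odd_map_circle]). *)

(** * Cochains mod 2 on ordered simplices *)

Section cochains.
Context {T : Type}.
Implicit Types (phi psi : seq T -> bool) (s t : seq T).

(** A cochain mod 2 is a function on lists of vertices, with the empty list as the
simplex of dimension [-1]. The sum over the faces is organised by whether the
first vertex is the deleted one, so that statements about it follow by induction
on the simplex, for all cochains at once. *)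
Fixpoint coboundary phi s : bool :=
  if s is x :: s' then
    phi s' (+) coboundary (fun t => phi (x :: t)) s'
  else false.

Lemma eq_coboundaryT phi psi s : phi =1 psi ->
  coboundary phi s = coboundary psi s.
Proof.
elim: s phi psi => //= x s IHs phi psi eq_phi; rewrite eq_phi.
by congr (_ (+) _); apply: IHs => t; exact: eq_phi.
Qed.

Lemma coboundaryD phi psi s :
  coboundary (fun t => phi t (+) psi t) s = coboundary phi s (+) coboundary psi s.
Proof. by elim: s phi psi => //= x s IHs phi psi; rewrite IHs addbACA. Qed.

Lemma coboundary0 s : coboundary (fun=> false) s = false.
Proof. by elim: s. Qed.

Lemma coboundaryK phi s : coboundary (coboundary phi) s = false.
Proof.
elim: s phi => //= x s IHs phi.
by rewrite coboundaryD IHs addbF addbb.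
Qed.

End cochains.

Lemma coboundary_map (T T' : Type) (f : T -> T') (phi : seq T' -> bool) s :
  coboundary (fun t => phi (map f t)) s = coboundary phi (map f s).
Proof.
elim: s phi => //= x s IHs phi; congr (_ (+) _).
exact: (IHs (fun t => phi (f x :: t))).
Qed.

Lemma eq_coboundary (T : eqType) (phi psi : seq T -> bool) s :
    (forall t, subseq t s -> (size t).+1 = size s -> phi t = psi t) ->
  coboundary phi s = coboundary psi s.
Proof.
elim: s phi psi => //= x s IHs phi psi eq_phi.
rewrite eq_phi; [|exact: subseq_cons|by []]; congr (_ (+) _); apply: IHs => t ts tS.
by apply: eq_phi; rewrite /= ?eqxx ?tS.
Qed.

(** In this form the coboundary of a cochain that ignores the order of the vertices
is visibly a cochain of the same kind. *)
Lemma coboundary_rem (T : eqType) (phi : seq T -> bool) s :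
    (forall t u, perm_eq t u -> phi t = phi u) ->
  coboundary phi s = \big[addb/false]_(x <- s) phi (rem x s).
Proof.
elim: s phi => [|x s IHs] phi phi_perm; first by rewrite big_nil.
rewrite big_cons /= eqxx IHs; last first.
  by move=> t u tu; apply: phi_perm; rewrite perm_cons.
congr (_ (+) _); rewrite !big_seq; apply: eq_bigr => y ys.
case: eqVneq ys => [<-|//] xs; apply: phi_perm.
by rewrite perm_sym perm_to_rem.
Qed.

Lemma coboundary_perm (T : eqType) (phi : seq T -> bool) s t :
    (forall t u, perm_eq t u -> phi t = phi u) ->
  perm_eq s t -> coboundary phi s = coboundary phi t.
Proof.
move=> phi_perm st; rewrite !coboundary_rem// (perm_big _ st)/= !big_seq.
apply: eq_bigr => x xt; apply: phi_perm; rewrite -(perm_cons x).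
apply: (perm_trans _ (perm_to_rem xt)); apply: (perm_trans _ st).
by rewrite perm_sym perm_to_rem ?(perm_mem st).
Qed.

(** * Fan's cochain of alternating label sequences *)

Fixpoint alternates (b : bool) (s : seq bool) : bool :=
  if s is x :: s' then (x == b) && alternates (~~ b) s' else true.

Lemma alternatesN b s : alternates b (map negb s) = alternates (~~ b) s.
Proof. by elim: s b => //= x s IHs b; rewrite IHs; case: x b => -[]. Qed.

(** If two neighbouring signs agree, deleting any other sign leaves no alternating
sequence, and the two deletions within the pair give the same sequence. If all
signs alternate, then only deleting the last or the first one can leave an
alternating sequence, which starts with [b] or with [~~ b] respectively. *)
Lemma coboundary_alternates b s :
  coboundary (alternates b) s = alternates b s (+) alternates (~~ b) s.
Proof.
elim: s b => //= x s IHs b.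
case: eqVneq => [->|xb] /=.
  by rewrite IHs negbK /=; case: b => /=; do 2 case: alternates.
rewrite coboundary0 addbF; case: x b xb => -[]//= _; rewrite addbF//.
Qed.

(** The signed label [+ i] or [- i] is the natural number [2 * i + 1] or [2 * i], so
that sorting labels as numbers sorts them by absolute value, and the sign is
the parity. *)
Definition flip (x : nat) := if odd x then x.-1 else x.+1.

Lemma flipE (b : bool) k : flip (b + k.*2) = (~~ b + k.*2)%N.
Proof. by rewrite /flip oddD odd_double addbF oddb; case: b. Qed.

Lemma odd_flip x : odd (flip x) = ~~ odd x.
Proof.
by rewrite -{1}(odd_double_half x) flipE oddD odd_double addbF oddb.
Qed.

Lemma flip_le x y : (x <= y)%N -> y != flip x -> (flip x <= flip y)%N.
Proof.
rewrite -(odd_double_half x) -(odd_double_half y) !flipE.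
by case: (odd x); case: (odd y); rewrite -!muln2 /= => xy /eqP; lia.
Qed.

Definition fan (lab : seq nat) := alternates true (map odd (sort leq lab)).

Definition no_complementary (lab : seq nat) :=
  {in lab &, forall x y, y != flip x}.

Lemma fan_perm s t : perm_eq s t -> fan s = fan t.
Proof.
move=> st; congr (alternates true (map odd _)).
by apply/perm_sortP => //; [exact: leq_total|exact: leq_trans|exact: anti_leq].
Qed.

(** Changing all the signs preserves the order of the labels, except between two
complementary labels: they share their absolute value and would be swapped. *)
Lemma fan_flip s : no_complementary s ->
  fan (map flip s) = alternates false (map odd (sort leq s)).
Proof.
move=> sN; rewrite /fan.
have -> : sort leq (map flip s) = map flip (sort leq s).
  apply: (sorted_eq leq_trans anti_leq).
  - exact: (sort_sorted leq_total).
  - rewrite sorted_map; have := sort_sorted leq_total s.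
    apply: (@sub_in_sorted _ (mem s)); last by rewrite all_sort; apply/allP.
    by move=> x y xs ys xy; apply: flip_le => //; exact: sN.
  - rewrite perm_sort (perm_map flip)// perm_sym perm_sort//.
rewrite -map_comp (eq_map (_ : odd \o flip =1 negb \o odd)).
  by rewrite map_comp alternatesN.
exact: odd_flip.
Qed.

(** Fan's identity. Once the labels are sorted, it is the identity for sequences of
signs: a repeated absolute value is a repeated label, thus a repeated sign. *)
Lemma coboundary_fan s : no_complementary s ->
  coboundary fan s = fan s (+) fan (map flip s).
Proof.
move=> sN; rewrite fan_flip// /fan -(coboundary_alternates true).
have -> : coboundary fan s = coboundary fan (sort leq s).
  apply: coboundary_perm; first exact: fan_perm.
  by rewrite perm_sym perm_sort.
have := sort_sorted leq_total s; move: (sort leq s) => {sN}s ss.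
rewrite -(coboundary_map odd (alternates true)).
apply: eq_coboundary => t ts _.
by rewrite /fan sorted_sort//;
  [exact: leq_trans|exact: (subseq_sorted leq_trans ts ss)].
Qed.

Lemma half_ltn x y : (x <= y)%N -> y != flip x -> odd x != odd y ->
  (x./2 < y./2)%N.
Proof.
rewrite -(odd_double_half x) -(odd_double_half y).
move: (odd x) (x./2) (odd y) (y./2) => b i c j.
rewrite flipE !half_bit_double !oddD !odd_double !addbF !oddb.
by case: b; case: c; rewrite -!muln2 //= => xy /eqP; lia.
Qed.

(** Without complementary labels, neighbouring labels of opposite signs have
different absolute values; so these values increase strictly along an
alternating sequence. *)
Lemma fan_size m (s : seq nat) : no_complementary s ->
  {in s, forall x, x < m.*2}%N -> fan s -> (size s <= m)%N.
Proof.
rewrite /fan -(size_sort leq) => sN sm.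
have := sort_sorted leq_total s.
have {sN} : no_complementary (sort leq s).
  by move=> x y; rewrite !mem_sort; exact: sN.
have {sm} : {in sort leq s, forall x, x < m.*2}%N.
  by move=> x; rewrite mem_sort; exact: sm.
case: (sort leq s) => // x {}s sm sN; rewrite [sorted _ _]/= => xs xa.
suff: (size s + x./2 < m)%N by rewrite /=; lia.
elim: s x true sm sN xs xa => [|y s IHs] x b sm sN.
  move=> _ _; have := sm x (mem_head _ _).
  by rewrite -{1}(odd_double_half x) -!muln2 /=; lia.
move=> /= /andP[xy ys] /and3P[/eqP xb /eqP yb sa].
have : (size s + y./2 < m)%N.
  apply: (IHs y (~~ b)) => //=; last by rewrite yb eqxx.
    by move=> z zs; apply: sm; rewrite inE zs orbT.
  by move=> z w zs ws; apply: sN; rewrite inE ?zs ?ws orbT.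
have : (x./2 < y./2)%N.
  apply: half_ltn => //; last by rewrite xb yb; case: (b).
  by apply: sN; rewrite !inE eqxx ?orbT.
lia.
Qed.

(** * Barycentric subdivision *)

Section subdivision.
Context {R : realType} {V : normedModType R}.
Implicit Types (s t : seq V) (phi psi : seq V -> bool) (C : V -> Prop).

Definition barycenter s : V := (size s)%:R^-1 *: \sum_(v <- s) v.

Lemma barycenterN s : barycenter (map -%R s) = - barycenter s.
Proof.
by rewrite /barycenter size_map big_map/= sumrN scalerN.
Qed.

Lemma barycenterB s x : s != [::] ->
  barycenter s - x = (size s)%:R^-1 *: \sum_(v <- s) (v - x).
Proof.
move=> s0; rewrite /barycenter sumrB big_const_seq count_predT iter_addr_0.
rewrite scalerBr -[x *+ _]scaler_nat scalerA mulVf ?scale1r// pnatr_eq0.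
by rewrite size_eq0.
Qed.

Lemma barycenter_ball s x (r : R) : s != [::] ->
  {in s, forall v, `|v - x| <= r} -> `|barycenter s - x| <= r.
Proof.
move=> s0 sr; have s1 : 0 < (size s)%:R :> R by rewrite ltr0n lt0n size_eq0.
rewrite barycenterB// normrZ normfV normr_nat ler_pdivrMl//.
apply: le_trans (ler_norm_sum _ _ _) _.
rewrite big_seq mulr_natl -[X in _ *+ X]count_predT -iter_addr_0 -big_const_seq.
by rewrite [leRHS]big_seq; apply: ler_sum.
Qed.

Lemma barycenter_vertex s n (D : R) v : size s = n.+1 -> v \in s ->
  {in s &, forall u w, `|u - w| <= D} ->
  `|barycenter s - v| <= n%:R / n.+1%:R * D.
Proof.
move=> sn vs sD; have s0 : s != [::] by rewrite -size_eq0 sn.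
rewrite barycenterB// sn normrZ normfV normr_nat.
rewrite mulrC [leRHS]mulrAC ler_pM2r ?invr_gt0//.
rewrite (perm_big _ (perm_to_rem vs))/= big_cons subrr add0r.
have sr : size (rem v s) = n by rewrite size_rem// sn.
apply: le_trans (ler_norm_sum _ _ _) _.
rewrite mulr_natl -sr -[X in _ *+ X]count_predT -iter_addr_0.
rewrite -big_const_seq big_seq [leRHS]big_seq; apply: ler_sum => u us.
by apply: sD => //; exact: mem_rem us.
Qed.

(** The value of [phi] on the barycentric subdivision of a simplex [s] with [n]
vertices: the subdivision is the cone, from the barycenter of [s], over
the subdivided boundary of [s]. *)
Fixpoint sd n phi s : bool :=
  if n is n'.+1 then
    coboundary (sd n' (fun t => phi (barycenter s :: t))) s
  else phi [::].

Lemma eq_sd n phi psi s : phi =1 psi -> sd n phi s = sd n psi s.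
Proof.
elim: n phi psi s => //= n IHn phi psi s eq_phi.
by apply: eq_coboundaryT => t; apply: IHn => u; exact: eq_phi.
Qed.

Lemma sdD n phi psi s :
  sd n (fun t => phi t (+) psi t) s = sd n phi s (+) sd n psi s.
Proof.
elim: n phi psi s => //= n IHn phi psi s.
rewrite -coboundaryD; apply: eq_coboundaryT => t; exact: IHn.
Qed.

Lemma sd0 n s : sd n (fun=> false) s = false.
Proof.
elim: n s => //= n IHn s; rewrite -[RHS](coboundary0 s).
exact: eq_coboundaryT.
Qed.

Lemma sd_opp n phi s : sd n (fun t => phi (map -%R t)) s = sd n phi (map -%R s).
Proof.
elim: n phi s => //= n IHn phi s; rewrite -coboundary_map.
apply: eq_coboundaryT => t.
rewrite -(IHn (fun t => phi (barycenter (map -%R s) :: t))).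
by apply: eq_sd => u; rewrite barycenterN.
Qed.

(** Subdivision is a chain map. The coboundary of [phi] at the cone [b :: t] over
[t] is [phi t] plus the coboundary at [t] of [phi] on cones. Summing over
the boundary of [s], the first term gives the right-hand side, and the
second one vanishes because it is, by induction, a double coboundary. *)
Lemma sd_coboundary n phi s : size s = n.+1 ->
  sd n.+1 (coboundary phi) s = coboundary (sd n phi) s.
Proof.
elim: n phi s => [|n IHn] phi s sn.
  by case: s sn => [|x [|]] // _; rewrite /= !addbF.
set b := barycenter s.
transitivity (coboundary (sd n.+1 phi) s (+)
  coboundary (sd n.+1 (coboundary (fun t => phi (b :: t)))) s).
  rewrite -coboundaryD; apply: eq_coboundaryT => t.
  exact: (sdD n.+1 phi (coboundary (fun t => phi (b :: t)))).
rewrite [X in _ (+) X](_ : _ = false) ?addbF//.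
rewrite -[RHS](coboundaryK (sd n (fun t => phi (b :: t))) s).
apply: eq_coboundary => t _; rewrite sn => -[tn]; exact: IHn.
Qed.

Definition barycentrically_closed C := forall s, s != [::] ->
  {in s, forall v, C v} -> C (barycenter s).

(** Subdividing a simplex of diameter [D] with [n] vertices only involves simplices
of diameter at most [(n - 1) / n * D]. The induction runs over all predicates [C]
closed under barycenters because the bound for the edges at the barycenter [b] is
obtained by adding to [C] the ball around [b] that contains the vertices. *)
Lemma sd_local n C (D : R) phi psi s : size s = n ->
    barycentrically_closed C ->
    {in s, forall v, C v} -> {in s &, forall u v, `|u - v| <= D} ->
    (forall t, size t = n -> {in t, forall v, C v} ->
      {in t &, forall u v, `|u - v| <= n.-1%:R / n%:R * D} -> phi t = psi t) ->
  sd n phi s = sd n psi s.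
Proof.
elim: n C phi psi s => [|n IHn] C phi psi s sn CC Cs sD eq_phi.
  by rewrite /= eq_phi.
have s0 : s != [::] by rewrite -size_eq0 sn.
have [D0|D0] := ltP D 0.
  case: s sn s0 sD {Cs} => // x s _ _ /(_ x x).
  by rewrite mem_head subrr normr0 leNgt D0 => /(_ isT isT).
rewrite /=; apply: eq_coboundary => t ts; rewrite sn => -[tn].
set b := barycenter s; set r := n%:R / n.+1%:R * D.
have r0 : 0 <= r by rewrite /r mulr_ge0 ?divr_ge0.
have sb v : v \in s -> `|v - b| <= r.
  by move=> vs; rewrite distrC; exact: barycenter_vertex.
apply: (IHn (fun v => C v /\ `|v - b| <= r)) => //.
- move=> u u0 Cu; split; first by apply: CC => // v /Cu[].
  by apply: barycenter_ball => // v /Cu[].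
- by move=> v /(mem_subseq ts) vs; split; [exact: Cs|exact: sb].
- by move=> u v /(mem_subseq ts) us /(mem_subseq ts) vs; exact: sD.
move=> u un Cu uD; apply: eq_phi => /=; first by rewrite un.
  by move=> v; rewrite inE => /predU1P[->|/Cu[]//]; exact: CC.
have nr : n.-1%:R / n%:R * D <= r.
  apply: ler_wpM2r => //; case: (n) => [|m]; first by rewrite invr0 mul0r.
  rewrite /= ler_pdivrMr// mulrAC ler_pdivlMr// -!natrM ler_nat; lia.
move=> v w; rewrite !inE => /predU1P[->|vu] /predU1P[->|wu].
- by rewrite subrr normr0.
- by rewrite distrC; case: (Cu _ wu).
- by case: (Cu _ vu).
- by apply: le_trans nr; exact: uD.
Qed.

Definition subdivide phi s := sd (size s) phi s.

End subdivision.

Section iterated_subdivision.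
Context {R : realType} {V : normedModType R}.
Implicit Types (s t : seq V) (phi psi : seq V -> bool) (C : V -> Prop).

Lemma subdivide_coboundary phi s :
  subdivide (coboundary phi) s = coboundary (subdivide phi) s.
Proof.
case sn : (size s) => [|n]; first by case: s sn.
rewrite /subdivide sn sd_coboundary//; apply: eq_coboundary => t _.
by rewrite sn => -[->].
Qed.

Lemma iter_subdivide_coboundary m phi s :
  iter m subdivide (coboundary phi) s = coboundary (iter m subdivide phi) s.
Proof.
elim: m s => //= m IHm s; rewrite -subdivide_coboundary.
exact: eq_sd.
Qed.

Lemma iter_subdivide_opp m phi s :
  iter m subdivide (fun t => phi (map -%R t)) s =
  iter m subdivide phi (map -%R s).
Proof.
elim: m s => //= m IHm s; rewrite /subdivide size_map -sd_opp.
exact: eq_sd.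
Qed.

Lemma iter_subdivideD m phi psi s :
  iter m subdivide (fun t => phi t (+) psi t) s =
  iter m subdivide phi s (+) iter m subdivide psi s.
Proof.
elim: m s => //= m IHm s; rewrite /subdivide -sdD.
exact: eq_sd.
Qed.

Lemma iter_subdivide0 m s : iter m subdivide (fun=> false) s = false.
Proof.
elim: m s => //= m IHm s; rewrite -[RHS](sd0 (size s) s).
exact: eq_sd.
Qed.

Lemma iter_subdivide_nil m phi : iter m subdivide phi [::] = phi [::].
Proof. by elim: m. Qed.

Lemma iter_subdivide_local N m C (D : R) phi psi s : (size s <= N.+1)%N ->
    0 <= D -> barycentrically_closed C ->
    {in s, forall v, C v} -> {in s &, forall u v, `|u - v| <= D} ->
    (forall t, size t = size s -> {in t, forall v, C v} ->
      {in t &, forall u v, `|u - v| <= (N%:R / N.+1%:R) ^+ m * D} ->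
      phi t = psi t) ->
  iter m subdivide phi s = iter m subdivide psi s.
Proof.
move=> sN D0 CC; set q := _ / _.
have q0 : 0 <= q by rewrite /q divr_ge0.
elim: m D D0 s sN => [|m IHm] D D0 s sN Cs sD eq_phi.
  by apply: eq_phi => // u v us vs; rewrite expr0 mul1r; exact: sD.
rewrite !iterS /subdivide; apply: (sd_local (C := C) (D := D)) => //.
move=> t ts Ct tD; apply: (IHm (q * D)) => //.
- by rewrite mulr_ge0.
- by rewrite ts.
- move=> u v ut vt; apply: le_trans (tD u v ut vt) _; apply: ler_wpM2r => //.
  case: (size s) sN => [|n] nN; first by rewrite invr0 mulr0.
  rewrite /q ler_pdivrMr// mulrAC ler_pdivlMr// -!natrM ler_nat /=; lia.
- move=> u us Cu uD; apply: eq_phi => //; first by rewrite us.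
  by move=> v w vu wu; rewrite exprSr -mulrA; exact: uD.
Qed.

End iterated_subdivision.

(** * The octahedral sphere and Tucker's lemma *)

Section octahedron.
Context {V : zmodType} (e : nat -> V).
Implicit Types (phi psi : seq V -> bool) (bs : seq bool).

(** The sum of [phi] over the facets of the octahedral sphere with the vertices
[e j] and [- e j] for [j < k], each of which is listed by [orthant_simplex] for
one sequence of signs. *)
Fixpoint octahedron k phi : bool :=
  if k is k'.+1 then
    octahedron k' (fun t => phi (e k' :: t)) (+)
    octahedron k' (fun t => phi (- e k' :: t))
  else phi [::].

Fixpoint orthant_simplex bs : seq V :=
  if bs is b :: bs' then
    (if b then - e (size bs') else e (size bs')) :: orthant_simplex bs'
  else [::].

Lemma size_orthant_simplex bs : size (orthant_simplex bs) = size bs.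
Proof. by elim: bs => //= b bs ->. Qed.

Lemma octahedron_local k phi psi :
    (forall bs, size bs = k ->
      phi (orthant_simplex bs) = psi (orthant_simplex bs)) ->
  octahedron k phi = octahedron k psi.
Proof.
elim: k phi psi => [|k IHk] phi psi eq_phi; first exact: (eq_phi [::]).
congr (_ (+) _); apply: IHk => bs bsk.
  by have := eq_phi (false :: bs); rewrite /= bsk => ->.
by have := eq_phi (true :: bs); rewrite /= bsk => ->.
Qed.

Lemma octahedronD k phi psi :
  octahedron k (fun t => phi t (+) psi t) =
  octahedron k phi (+) octahedron k psi.
Proof. by elim: k phi psi => //= k IHk phi psi; rewrite !IHk addbACA. Qed.

Lemma octahedron0 k : octahedron k (fun=> false) = false.
Proof. by elim: k => //= k ->. Qed.

Lemma octahedron_opp k phi :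
  octahedron k (fun t => phi (map -%R t)) = octahedron k phi.
Proof.
elim: k phi => //= k IHk phi; rewrite addbC opprK; congr (_ (+) _).
  exact: (IHk (fun t => phi (e k :: t))).
exact: (IHk (fun t => phi (- e k :: t))).
Qed.

Lemma octahedron_coboundary k phi : octahedron k (coboundary phi) = false.
Proof. by elim: k phi => //= k IHk phi; rewrite !octahedronD !IHk !addbF addbb. Qed.

(** Write the hemisphere as the cone from [e k] over the equator. The equator is a
cycle, so the coboundary of [phi], summed over the hemisphere, is the sum of
[phi] over the equator. By hypothesis it is also the sum of [phi] over the
hemisphere plus the antipode of that sum, i.e., the sum over the whole sphere.
So the dimension can be lowered to [-1]. *)
Lemma octahedron_index k phi :
    (forall bs, (size bs <= k)%N -> coboundary phi (orthant_simplex bs) =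
      phi (orthant_simplex bs) (+) phi (map -%R (orthant_simplex bs))) ->
  octahedron k phi = phi [::].
Proof.
elim: k => //= k IHk phiE; rewrite -IHk; last first.
  by move=> bs bsk; apply: phiE; exact: leqW.
have -> : octahedron k phi = octahedron k (fun t => coboundary phi (e k :: t)).
  by rewrite /= octahedronD octahedron_coboundary addbF.
rewrite -[X in _ (+) X]octahedron_opp -octahedronD.
apply: octahedron_local => bs bsk.
by have := phiE (false :: bs); rewrite /= bsk => ->.
Qed.

End octahedron.

(** Iterated subdivision makes the simplices so small that close points do not
have complementary labels, so that Fan's identity holds on all of them. Then some
simplex with [k + 1 > m] vertices has alternating labels, which [fan_size]
excludes. The sets [C bs] keep track of the orthant that is subdivided. *)
Lemma tucker (R : realType) (V : normedModType R) (e : nat -> V) (k m : nat)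
    (K : set V) (C : seq bool -> V -> Prop) (D delta : R) (lab : V -> nat) :
    (m <= k)%N -> 0 <= D -> 0 < delta ->
    (forall bs, (size bs <= k.+1)%N ->
      [/\ barycentrically_closed (C bs), forall v, C bs v -> K v,
          {in orthant_simplex e bs, forall v, C bs v} &
          {in orthant_simplex e bs &, forall u v, `|u - v| <= D}]) ->
    (forall v, K v -> (lab v < m.*2)%N) ->
    (forall v, K v -> lab (- v) = flip (lab v)) ->
  exists u v, [/\ K u, K v, `|u - v| < delta & lab u = flip (lab v)].
Proof.
move=> mk D0 delta0 KC labm labN; apply: contrapT => noedge.
set q : R := k%:R / k.+1%:R.
have [M qM] : exists M, q ^+ M * D < delta.
  have : (fun n => q ^+ n * D) @ \oo --> (0 : R).
    rewrite -[X in _ --> X](mul0r D); apply: cvgMl; apply: cvg_expr.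
    by rewrite ger0_norm ?divr_ge0// ltr_pdivrMr// mul1r ltr_nat.
  move=> /cvgr_lt /(_ _ delta0) [M _ HM]; exists M; exact: HM (leqnn M).
have small (bs : seq bool) phi psi : (size bs <= k.+1)%N ->
    (forall t : seq V, size t = size bs -> {in t, forall v, K v} ->
      no_complementary (map lab t) -> phi t = psi t) ->
    iter M subdivide phi (orthant_simplex e bs) =
    iter M subdivide psi (orthant_simplex e bs).
  move=> bsk eq_phi; have [Cclosed CK Cbs bsD] := KC bs bsk.
  apply: (iter_subdivide_local (N := k) (C := C bs) (D := D)) => //.
    by rewrite size_orthant_simplex.
  move=> t; rewrite size_orthant_simplex => ts Ct tD.
  have Kt v : v \in t -> K v by move=> /Ct /CK.
  apply: eq_phi => // _ _ /mapP[v vt ->] /mapP[u ut ->].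
  apply/eqP => uv; apply: noedge; exists u, v; split => //; try exact: Kt.
  by apply: le_lt_trans qM; exact: tD.
set A := iter M subdivide (fun t => fan (map lab t)).
have : octahedron e k.+1 A = true.
  rewrite octahedron_index ?/A ?iter_subdivide_nil// => bs bsk.
  rewrite -iter_subdivide_coboundary -iter_subdivide_opp -iter_subdivideD.
  apply: small => // t ts Kt tN; rewrite coboundary_map coboundary_fan//.
  congr (_ (+) fan _); rewrite -!map_comp; apply/eq_in_map => v vt /=.
  by rewrite labN//; exact: Kt.
rewrite -[octahedron _ _ _]/(octahedron e k.+1 A).
suff -> : octahedron e k.+1 A = false by [].
rewrite -[RHS](octahedron0 e k.+1); apply: octahedron_local => bs bsk.
rewrite -[RHS](iter_subdivide0 M (orthant_simplex e bs)).
apply: small => [|t ts Kt tN]; first by rewrite bsk.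
have tm : {in map lab t, forall x, x < m.*2}%N.
  by move=> _ /mapP[v vt ->]; apply: labm; exact: Kt.
apply/negP => /(fan_size tN tm).
by rewrite size_map ts bsk ltnNge mk.
Qed.

(** * The Borsuk--Ulam theorem *)

Section sphere_projection.
Context {R : realType} {k : nat}.
Implicit Types u v : 'rV[R]_k.+1.

Lemma inner_ge0 v : 0 <= inner v v.
Proof. by apply: sumr_ge0 => i _; rewrite -expr2 sqr_ge0. Qed.

Lemma inner_eq0 v : inner v v = 0 -> v = 0.
Proof.
move=> /eqP; rewrite psumr_eq0 => [/allP v0|i _]; last first.
  by rewrite -expr2 sqr_ge0.
apply/rowP => i; rewrite mxE; apply/eqP.
by have := v0 i (mem_index_enum _); rewrite /= mulf_eq0 orbb.
Qed.

Lemma eucl_norm_gt0 v : v != 0 -> 0 < eucl_norm v.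
Proof.
move=> v0; rewrite /eucl_norm sqrtr_gt0 lt_neqAle inner_ge0 andbT eq_sym.
by apply: contra v0 => /eqP /inner_eq0 ->.
Qed.

Lemma innerZ (a b : R) u v : inner (a *: u) (b *: v) = a * b * inner u v.
Proof.
by rewrite /inner mulr_sumr; apply: eq_bigr => i _; rewrite !mxE mulrACA.
Qed.

Lemma normalize_sphere v : v != 0 -> sphere R k ((eucl_norm v)^-1 *: v).
Proof.
move=> v0; rewrite /sphere/= /eucl_norm innerZ -expr2 -/(eucl_norm v).
rewrite sqrtrM ?sqr_ge0// sqrtr_sqr -/(eucl_norm v).
by rewrite ger0_norm ?invr_ge0 ?sqrtr_ge0// mulVf// gt_eqF ?eucl_norm_gt0.
Qed.

Let base_neq0 : (delta_mx 0 0 : 'rV[R]_k.+1) != 0.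
Proof.
by apply/eqP => /rowP/(_ 0)/eqP; rewrite !mxE !eqxx oner_eq0.
Qed.

Definition sphere_base : sphere R k :=
  exist (fun v => v \in sphere R k) _ (mem_set (normalize_sphere base_neq0)).

(** The value at [0] is arbitrary. *)
Definition sphere_proj v : sphere R k :=
  insubd sphere_base ((eucl_norm v)^-1 *: v).

Lemma val_sphere_proj v : v != 0 ->
  val (sphere_proj v) = (eucl_norm v)^-1 *: v.
Proof.
by move=> v0; rewrite insubdK//; exact/mem_set/normalize_sphere.
Qed.

Lemma sphere_projN v : v != 0 -> sphere_proj (- v) = antipode (sphere_proj v).
Proof.
move=> v0; apply: val_inj; rewrite /= !val_sphere_proj ?oppr_eq0// scalerN.
by rewrite /eucl_norm innerNN.
Qed.

Lemma inner_continuous : continuous (fun v => inner v v).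
Proof.
apply: continuous_big => [|i _ v]; first exact: add_continuous.
exact: continuousM (@coord_continuous R 1 k.+1 0 i v) (@coord_continuous R 1 k.+1 0 i v).
Qed.

Lemma sphere_proj_continuous v : v != 0 -> sphere_proj @ v --> sphere_proj v.
Proof.
move=> v0 U [W [[Q oQ <-] Qv] QU].
suff : \forall u \near v, Q (val (sphere_proj u)) by apply: filterS => u /QU.
have norm_cont : {for v, continuous (@eucl_norm R k)}.
  exact: (continuous_comp (@inner_continuous v) (@sqrt_continuous R _)).
have nv : {for v, continuous (fun u => (eucl_norm u)^-1 *: u)}.
  by apply: continuousZ; [apply: continuousV; rewrite ?gt_eqF ?eucl_norm_gt0|].
have : \forall u \near v, Q ((eucl_norm u)^-1 *: u).
  apply: nv; apply: open_nbhs_nbhs; split => //.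
  by rewrite -val_sphere_proj.
have : \forall u \near v, 0 < inner u u.
  apply: (cvgr_gt _ (@inner_continuous v)).
  by rewrite -sqrtr_gt0 -/(eucl_norm v) eucl_norm_gt0.
apply: filterS2 => u u0; rewrite val_sphere_proj//.
by apply: contraTneq u0 => ->; rewrite /inner big1 ?ltxx// => i _; rewrite mxE mul0r.
Qed.

End sphere_projection.

Lemma rV_norm_le (R : realType) n (v : 'rV[R]_n) (r : R) : 0 <= r ->
  (forall i, `|v 0 i| <= r) -> `|v| <= r.
Proof.
move=> r0 vr; rewrite [leLHS]/Num.norm /= mx_normrE.
by apply: bigmax_le => //= -[i j] _; rewrite ord1.
Qed.

Lemma orthant_simplexP (V : zmodType) (e : nat -> V) bs v :
  v \in orthant_simplex e bs ->
  exists2 j, (j < size bs)%N & v = if nth false (rev bs) j then - e j else e j.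
Proof.
elim: bs => //= b bs IHbs; rewrite inE => /predU1P[->|/IHbs[j jbs ->]].
  by exists (size bs); rewrite // rev_cons nth_rcons size_rev ltnn eqxx.
by exists j; [exact: ltnW|rewrite rev_cons nth_rcons size_rev jbs].
Qed.

(** Suppose that the [g i] have no common zero. By compactness there is a scale [d]
such that near each point of [K], at scale [d], some [g i] keeps a constant sign;
one such [i], chosen in the same way at opposite points, and this sign form the
label of the point. The set [K] is compact, symmetric and avoids [0]. It contains
the octahedral sphere: a facet lies in the unit ball of the sup norm, and a sum of
coordinates with fixed signs equals [1] on it. *)
Theorem borsuk_ulam (R : realType) (k m : nat) (g : 'I_m -> sphere R k -> R) :
    (m <= k)%N -> (forall i, continuous (g i)) ->
    (forall i x, g i (antipode x) = - g i x) ->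
  exists x, forall i, g i x = 0.
Proof.
move=> mk gc gN; apply: contrapT => g0.
pose K := [set v : 'rV[R]_k.+1 | `|v| <= 1 /\ 1 <= \sum_i `|v 0 i|].
have K0 v : K v -> v != 0.
  case=> _; apply: contraTneq => ->; rewrite big1 ?ltNge ?ler10// => i _.
  by rewrite mxE normr0.
have KN v : K v -> K (- v).
  by rewrite /K /= normrN; under [in X in _ -> X]eq_bigr do rewrite mxE normrN.
have cK : compact K.
  apply: bounded_closed_compact.
    by exists 1; split => // x x1 v [v1 _]; apply: le_trans v1 (ltW x1).
  apply: closedI.
    apply: (@preimage_closed _ _ (fun v : 'rV[R]_k.+1 => `|v|) [set x | x <= 1]).
      by move=> v _; exact: (@norm_continuous _ 'rV[R]_k.+1 v).
    exact: closed_le.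
  apply: (@preimage_closed _ _ (fun v : 'rV[R]_k.+1 => \sum_i `|v 0 i|)
      [set x | 1 <= x]); last exact: closed_ge.
  move=> v0 _; apply: continuous_big => [|i _ v]; first exact: add_continuous.
  exact: (continuous_comp (@coord_continuous R 1 k.+1 0 i v) (@norm_continuous _ _ _)).
pose G i v := g i (sphere_proj v).
have GN i v : K v -> G i (- v) = - G i v.
  by move=> /K0 v0; rewrite /G sphere_projN.
pose stable d v i := forall u, K u -> `|u - v| < d -> 0 < G i v * G i u.
have [d d0 stableK] : exists2 d, 0 < d & forall v, K v -> exists i, stable d v i.
  have : \forall d \near 0^'+, K `<=` [set v | exists i, stable d v i].
    move: cK => /compact_near_coveringP; apply => v Kv.
    have [i /eqP Giv0] : exists i, G i v <> 0.
      apply/not_existsP => Gv; apply: g0; exists (sphere_proj v) => i.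
      by apply: contrapT; exact: Gv.
    have [e e0 ve] : exists2 e, 0 < e &
        forall u, `|v - u| < e -> 0 < G i v * G i u.
      have : \forall u \near v, 0 < G i v * G i u.
        have Gc : {for v, continuous (G i)}.
          exact: (continuous_comp (sphere_proj_continuous (K0 v Kv)) (gc i _)).
        have Gc2 : {for v, continuous (fun u => G i v * G i u)}.
          apply: (@continuousM _ _ (fun=> G i v) (G i) v) => //; exact: cst_continuous.
        apply: (cvgr_gt _ Gc2).
        by rewrite -expr2 exprn_even_gt0.
      by move=> /nbhs_normP[e e0 ve]; exists e => // u uv; apply: ve.
    have vnear : \forall w \near v, `|v - w| < e / 2.
      by apply/nbhs_normP; exists (e / 2) => //=; rewrite divr_gt0.
    near=> w d; exists i => u Ku uw.
    have vw : `|v - w| < e / 2.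
      by near: w; exact: vnear.
    have de : d < e / 2 by near: d; apply: nbhs_right_lt; rewrite divr_gt0.
    have Gw : 0 < G i v * G i w.
      by apply/ve/(lt_trans vw); rewrite ltr_pdivrMr// ltr_pMr// ltr1n.
    have Gu : 0 < G i v * G i u.
      apply: ve; rewrite (splitr e) -(subrKA w).
      rewrite (le_lt_trans (ler_normD _ _))// ltrD// distrC.
      exact: lt_trans de.
    have := mulr_gt0 Gw Gu => /=.
    by rewrite mulrACA pmulr_rgt0// -expr2 exprn_even_gt0.
  move=> stab; have [d [dK d0]] := filter_ex (filterI stab (nbhs_right_gt 0)).
  by exists d.
have stableN v i : K v -> stable d v i -> stable d (- v) i.
  move=> Kv vi u Ku; rewrite opprK => uv.
  rewrite GN// mulNr -mulrN -GN//; apply: vi; first exact: KN.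
  by rewrite -opprD normrN.
have stableNE v i : K v -> `[< stable d (- v) i >] = `[< stable d v i >].
  move=> Kv; apply/asboolP/asboolP; last exact: stableN.
  by move=> /(stableN _ _ (KN v Kv)); rewrite opprK.
pose lab v := if [pick i | `[< stable d v i >]] is Some i
  then ((0 < G i v)%R + (val i).*2)%N else 0%N.
have labP v : K v -> exists2 i, stable d v i & lab v = ((0 < G i v)%R + (val i).*2)%N.
  move=> Kv; rewrite /lab; case: pickP => [i /asboolP|]; first by exists i.
  by move=> none; have [i /asboolP] := stableK v Kv; rewrite none.
have GE0 v i : K v -> stable d v i -> G i v != 0.
  move=> Kv /(_ v Kv); rewrite subrr normr0 => /(_ d0).
  by apply: contraTneq => ->; rewrite mul0r ltxx.
pose C bs := [set v : 'rV[R]_k.+1 | `|v| <= 1 /\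
  \sum_(i < k.+1) (-1) ^+ nth false (rev bs) i * v 0 i = 1].
pose e j : 'rV[R]_k.+1 := delta_mx 0 (inord j).
have [] := @tucker R _ e k m K C 2 d lab mk _ d0.
- by [].
- move=> bs bsk; have CK v : C bs v -> K v.
    move=> [v1 vs]; split => //; rewrite -vs; apply: ler_sum => i _.
    by apply: le_trans (ler_norm _) _; rewrite normrM normrX normrN1 expr1n mul1r.
  have Ce v : v \in orthant_simplex e bs -> C bs v.
    move=> /orthant_simplexP[j jbs ->].
    have jk : (j < k.+1)%N by exact: leq_trans jbs bsk.
    split.
      rewrite (fun_if (fun w => `|w|)) normrN if_same.
      by apply: rV_norm_le => // i; rewrite mxE normr_nat; case: (_ && _).
    rewrite (bigD1 (inord j))//= big1 ?addr0 => [|i ij]; last first.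
      by case: ifP; rewrite !mxE eqxx (negbTE ij) ?oppr0 mulr0.
    rewrite inordK//; case: ifP; rewrite !mxE !eqxx ?expr1 ?mulrNN ?mulr1//.
  split => //.
  + move=> s s0 Cs; split.
      by rewrite -[barycenter s]subr0; apply: barycenter_ball => // v /Cs[]; rewrite subr0.
    under eq_bigr => i _ do rewrite mxE summxE mulrCA mulr_sumr.
    rewrite -mulr_sumr exchange_big/= big_seq (eq_bigr (fun=> 1)) => [|v /Cs[]//].
    rewrite -big_seq big_const_seq count_predT iter_addr_0 mulVf//.
    by rewrite pnatr_eq0 size_eq0.
  + move=> u v /Ce[u1 _] /Ce[v1 _]; apply: le_trans (ler_normB _ _) _.
    by rewrite -[2]/(1 + 1) lerD.
- move=> v /labP[i _ ->]; have := ltn_ord i; case: (0 < _); rewrite -!muln2 /=; lia.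
- move=> v Kv; rewrite /lab (eq_pick (fun i => stableNE v i Kv)).
  case: pickP => [i /asboolP vi|none]; last first.
    by have [i /asboolP] := stableK v Kv; rewrite none.
  by rewrite flipE GN// oppr_gt0 -leNgt le_eqVlt (negbTE (GE0 v i Kv vi)).
move=> u [v [Ku Kv uv]].
have [i ui ->] := labP u Ku; have [j vj ->] := labP v Kv; rewrite flipE.
move=> uvE; have ij : i = j.
  apply: val_inj => /=; move: uvE; rewrite -!muln2.
  by case: (0 < G i u); case: (0 < G j v) => /=; lia.
subst j; have := vj u Ku uv; move: uvE => /addIn.
case: (ltP 0 (G i v)) => Gv; case: (ltP 0 (G i u)) => Gu // _.
  by rewrite pmulr_rgt0// ltNge Gu.
by rewrite pmulr_lgt0// ltNge Gv.
Unshelve. all: by end_near. Qed.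

(** * Binary forms on the circle *)

Section binary_forms.
Context {R : realType}.
Implicit Types (f g : R -> R) (p q : {poly R}) (n : nat) (a t : R).

(** Forms of degree [n] in [cos a] and [sin a]. This recursive description, by the
quotients with respect to the two variables, makes rotations and products with
linear forms immediate; [isform_poly] converts it to coefficients. *)
Fixpoint isform n f : Prop :=
  if n is n'.+1 then
    exists g h, [/\ isform n' g, isform n' h &
      f = (fun a => cos a * g a + sin a * h a)]
  else exists c, f = (fun=> c).

Lemma isformD n f g : isform n f -> isform n g -> isform n (fun a => f a + g a).
Proof.
elim: n f g => [|n IHn] f g /=.
  by move=> [c ->] [d ->]; exists (c + d).
move=> [f1 [f2 [nf1 nf2 ->]]] [g1 [g2 [ng1 ng2 ->]]].
exists (fun a => f1 a + g1 a), (fun a => f2 a + g2 a).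
by split; [exact: IHn..|apply/funext => a; ring].
Qed.

Lemma isformZ n (c : R) f : isform n f -> isform n (fun a => c * f a).
Proof.
elim: n f => [|n IHn] f /=; first by move=> [d ->]; exists (c * d).
move=> [f1 [f2 [nf1 nf2 ->]]]; exists (fun a => c * f1 a), (fun a => c * f2 a).
by split; [exact: IHn..|apply/funext => a; ring].
Qed.

Lemma isform_linear n (c d : R) f : isform n f ->
  isform n.+1 (fun a => (c * cos a + d * sin a) * f a).
Proof.
move=> nf; exists (fun a => c * f a), (fun a => d * f a).
by split; [exact: isformZ..|apply/funext => a; ring].
Qed.

Lemma isform_shift n t f : isform n f -> isform n (fun a => f (a + t)).
Proof.
elim: n f => [|n IHn] f /=; first by move=> [d ->]; exists d.
move=> [g [h [/IHn ng /IHn nh ->]]].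
have := isformD (isform_linear (cos t) (- sin t) ng)
                (isform_linear (sin t) (cos t) nh).
congr (isform n.+1 _); apply/funext => a; rewrite cosD sinD; ring.
Qed.

Lemma isform_sin n t f : isform n f -> isform n.+1 (fun a => sin (t - a) * f a).
Proof.
move=> /(isform_linear (sin t) (- cos t)).
congr (isform n.+1 _); apply/funext => a; rewrite sinB; ring.
Qed.

Lemma isform_sincos n :
  isform n (fun a => cos (n%:R * a)) /\ isform n (fun a => sin (n%:R * a)).
Proof.
elim: n => [|n [nc ns]].
  by split; [exists 1|exists 0]; apply/funext => a; rewrite mul0r ?cos0 ?sin0.
split.
  have := isformD (isform_linear 1 0 nc) (isform_linear 0 (-1) ns).
  congr (isform n.+1 _); apply/funext => a.
  rewrite -natr1 [(_ + 1) * a]mulrDl (mul1r a) cosD; ring.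
have := isformD (isform_linear 1 0 ns) (isform_linear 0 1 nc).
congr (isform n.+1 _); apply/funext => a.
rewrite -natr1 [(_ + 1) * a]mulrDl (mul1r a) sinD; ring.
Qed.

Definition form_of_poly n p a : R :=
  \sum_(i < n.+1) p`_i * cos a ^+ (n - i) * sin a ^+ i.

Lemma isform_of_poly n p : isform n (form_of_poly n p).
Proof.
have isform_monomial i j : isform (i + j) (fun a => cos a ^+ i * sin a ^+ j).
  elim: i => [|i IHi]; last first.
    have := isform_linear 1 0 IHi; congr (isform _ _); apply/funext => a.
    by rewrite exprS; ring.
  elim: j => [|j IHj]; first by exists 1; apply/funext => a; rewrite !expr0 mulr1.
  have := isform_linear 0 1 IHj; congr (isform _ _); apply/funext => a.
  by rewrite exprS; ring.
have isform0 : isform n (fun=> 0).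
  have := isformZ 0 (isform_monomial n 0%N); rewrite addn0.
  by congr (isform _ _); apply/funext => a; rewrite mul0r.
rewrite (_ : form_of_poly n p = (fun a =>
    \sum_(i < n.+1) p`_i * (cos a ^+ (n - i) * sin a ^+ i))); last first.
  by apply/funext => a; apply: eq_bigr => i _; rewrite mulrA.
elim: (index_enum _) => [|i s IHs].
  by under eq_fun do rewrite big_nil.
under eq_fun do rewrite big_cons.
apply: isformD IHs; apply: isformZ; have := isform_monomial (n - i)%N i.
by rewrite subnK// -ltnS.
Qed.

Lemma form_of_polyS n p q a : (size p <= n.+1)%N ->
  form_of_poly n.+1 (p + 'X * q) a =
  cos a * form_of_poly n p a + sin a * form_of_poly n q a.
Proof.
move=> pn; rewrite /form_of_poly !mulr_sumr.
under eq_bigr do rewrite coefD coefXM -mulrA mulrDl.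
rewrite big_split/=; congr (_ + _).
  rewrite big_ord_recr/= nth_default// mul0r addr0; apply: eq_bigr => i _ /=.
  by rewrite subSn ?exprS; [ring|rewrite -ltnS].
rewrite big_ord_recl/= mul0r add0r; apply: eq_bigr => i _ /=.
by rewrite /bump/= add1n subSS exprS; ring.
Qed.

Lemma isform_poly n f : isform n f ->
  exists2 p : {poly R}, (size p <= n.+1)%N & f = form_of_poly n p.
Proof.
elim: n f => [|n IHn] f /=.
  move=> [c ->]; exists c%:P; first exact: size_polyC_leq1.
  by apply/funext => a; rewrite /form_of_poly big_ord1 coefC !expr0 !mulr1.
move=> [g [h [/IHn[p pn ->] /IHn[q qn ->] ->]]].
exists (p + 'X * q).
  rewrite (leq_trans (size_polyD _ _))// geq_max (leq_trans pn)//=.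
  by rewrite mulrC (leq_trans (size_polyMleq _ _))// size_polyX addn2.
by apply/funext => a; rewrite form_of_polyS.
Qed.

(** On an open half circle, a form is a polynomial in the tangent up to a positive
or negative factor without zeros. *)
Lemma form_of_poly_tan n p a : (size p <= n.+1)%N -> cos a != 0 ->
  form_of_poly n p a = cos a ^+ n * p.[tan a].
Proof.
move=> pn a0; rewrite (horner_coef_wide _ pn) mulr_sumr.
apply: eq_bigr => i _; have iN : (i <= n)%N by rewrite -ltnS.
have -> : cos a ^+ n = cos a ^+ (n - i) * cos a ^+ i by rewrite -exprD subnK.
have := expf_neq0 i a0; rewrite /tan expr_div_n.
move: (p`_i) (cos a ^+ (n - i)) (cos a ^+ i) (sin a ^+ i) => u v w z w0.
by field.
Qed.

Lemma poly_sign_changes n p (x : nat -> R) :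
    (forall j, (j <= n)%N -> x j < x j.+1) ->
    (forall j, (j <= n.+1)%N -> 0 < (-1) ^+ j * p.[x j]) ->
  (n.+1 < size p)%N.
Proof.
move=> xS px; have p0 : p != 0.
  by apply: contraTneq (px 0%N isT) => ->; rewrite horner0 mulr0 ltxx.
have /choice[r rP] j : exists r, (j <= n)%N -> [/\ x j < r, r < x j.+1 & root p r].
  have [jn|nj] := leqP j n; last by exists 0.
  have pj := px j (leqW jn); have pj1 := px j.+1 jn.
  have [z /andP[xz zx] rz] : exists2 z, x j <= z <= x j.+1 & root ((-1) ^+ j.+1 *: p) z.
    apply: poly_ivt; first exact/ltW/xS.
    by rewrite !hornerZ (ltW pj1) andbT exprS mulN1r mulNr oppr_le0 ltW.
  rewrite rootZ ?signr_eq0// in rz.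
  exists z => _; split => //.
    rewrite lt_neqAle xz andbT; apply: contraTneq pj => ->.
    by rewrite (rootP rz) mulr0 ltxx.
  rewrite lt_neqAle zx andbT; apply: contraTneq pj1 => <-.
  by rewrite (rootP rz) mulr0 ltxx.
have rS j : (j < n)%N -> r j < r j.+1.
  move=> jn; have [_ + _] := rP j (ltnW jn); have [+ _ _] := rP j.+1 jn.
  by move=> /[swap]; exact: lt_trans.
have rlt d j : (j + d < n)%N -> r j < r (j + d.+1)%N.
  elim: d j => [|d IHd] j; first by rewrite addn0 addn1; exact: rS.
  rewrite addnS => jdn; apply: (lt_trans (IHd j (ltnW jdn))).
  by rewrite [(j + d.+2)%N]addnS; apply: rS; rewrite addnS.
rewrite -(size_iota 0 n.+1) -(size_map r); apply: max_poly_roots => //.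
  by apply/allP => _ /mapP[j + ->]; rewrite mem_iota => /rP[].
rewrite map_inj_in_uniq ?iota_uniq// => i j; rewrite !mem_iota /= !add0n !ltnS => iN jn.
have neq u v : (u < v <= n)%N -> r u < r v.
  move=> /andP[uv vn]; have vE : v = (u + (v - u).-1.+1)%N by lia.
  by rewrite [in r v]vE; apply: rlt; lia.
by have [ij|ji|//] := ltngtP i j => rij; [have := neq i j|have := neq j i];
  rewrite rij ltxx ?ij ?ji ?iN ?jn => /(_ isT).
Qed.

(** In a half circle, which may be rotated to be centered at [0], the zeros of
a form correspond to the zeros of a polynomial of degree at most [n]. *)
Lemma form_sign_changes n f t (x : nat -> R) : isform n f ->
    (forall j, (j <= n)%N -> x j < x j.+1) ->
    (forall j, (j <= n.+1)%N -> t < x j < t + pi) ->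
    (forall j, (j <= n.+1)%N -> 0 < (-1) ^+ j * f (x j)) ->
  False.
Proof.
move=> nf xS xt fx.
have [p pn fE] := isform_poly (isform_shift (t + pi / 2) nf).
have xE j : f (x j) = form_of_poly n p (x j - (t + pi / 2)).
  by rewrite -fE subrK.
have pihalf : pi / 2 + pi / 2 = pi :> R by rewrite -splitr.
have xI j : (j <= n.+1)%N -> - (pi / 2) < x j - (t + pi / 2) < pi / 2.
  by move=> /xt/andP[? ?]; apply/andP; split; lra.
suff : (n.+1 < size p)%N by rewrite ltnNge pn.
apply: (@poly_sign_changes _ _ (fun j => tan (x j - (t + pi / 2)))).
  move=> j jn; rewrite ltr_tan ?ltrD2r ?xS// in_itv/= xI//; exact: leqW.
move=> j jn; have := fx j jn; have cj := cos_gt0_pihalf (xI j jn).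
by rewrite xE form_of_poly_tan ?gt_eqF// mulrCA pmulr_rgt0 ?exprn_gt0.
Qed.

End binary_forms.

(** * Points of the circle *)

Section circle.
Context {R : realType}.
Implicit Types (a b t : R) (x y : sphere R 1).

Lemma inner2 (u v : 'rV[R]_2) : inner u v = u 0 0 * v 0 0 + u 0 1 * v 0 1.
Proof.
rewrite /inner big_ord_recl big_ord1.
by rewrite (_ : lift ord0 ord0 = 1)//; exact/val_inj.
Qed.

Let circle_vec a : 'rV[R]_2 := \row_i (if i == 0 then cos a else sin a).

Let circle_vecP a : sphere R 1 (circle_vec a).
Proof.
by rewrite /sphere/= /eucl_norm inner2 !mxE/= -!expr2 cos2Dsin2 sqrtr1.
Qed.

Definition circle a : sphere R 1 :=
  exist (fun v => v \in sphere R 1) _ (mem_set (circle_vecP a)).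

Lemma circle0 a : val (circle a) 0 0 = cos a.
Proof. by rewrite /= mxE. Qed.

Lemma circle1 a : val (circle a) 0 1 = sin a.
Proof. by rewrite /= mxE. Qed.

Lemma circle_ext x y : val x 0 0 = val y 0 0 -> val x 0 1 = val y 0 1 -> x = y.
Proof.
move=> xy0 xy1; apply/val_inj/rowP => i.
by case: (splitP (i : 'I_(1 + 1))) => j; rewrite ord1 => ij;
  [rewrite (_ : i = 0)//|rewrite (_ : i = 1)//]; apply: val_inj.
Qed.

Lemma circleDpi a : circle (a + pi) = antipode (circle a).
Proof. by apply: circle_ext; rewrite /= !mxE/= ?cosDpi ?sinDpi. Qed.

Lemma circle_norm x : val x 0 0 ^+ 2 + val x 0 1 ^+ 2 = 1.
Proof.
have := set_mem (valP x); rewrite /sphere/= /eucl_norm inner2 -!expr2.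
by move=> /(congr1 (fun u => u ^+ 2)); rewrite sqr_sqrtr ?expr1n// addr_ge0 ?sqr_ge0.
Qed.

Lemma geodesic_circle a b : geodesic (circle a) (circle b) = acos (cos (a - b)).
Proof. by rewrite /geodesic inner2 !circle0 !circle1 cosB. Qed.

(** Each point of the circle is one of the two signs times a point of the half
circle starting at [t]. *)
Definition signed_circle t (c : R * bool) : sphere R 1 :=
  if c.2 then antipode (circle (t + c.1)) else circle (t + c.1).

Lemma signed_circle_surj t x : exists2 c, 0 <= c.1 < pi & x = signed_circle t c.
Proof.
pose u y := cos t * val y 0 0 + sin t * val y 0 1.
pose w y := cos t * val y 0 1 - sin t * val y 0 0.
have uw y : u y ^+ 2 + w y ^+ 2 = 1.
  rewrite -[RHS](circle_norm y) -[RHS]mul1r -(cos2Dsin2 t) /u /w; ring.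
have yE y a : cos a = u y -> sin a = w y -> y = circle (t + a).
  move=> ca sa; have ct := cos2Dsin2 t.
  apply: circle_ext; rewrite ?circle0 ?circle1 ?cosD ?sinD ca sa /u /w.
    by rewrite -[LHS]mul1r -ct; ring.
  by rewrite -[LHS]mul1r -ct; ring.
have upper y : 0 < w y \/ w y = 0 /\ u y = 1 ->
    exists2 a, 0 <= a < pi & y = circle (t + a).
  have u1 : -1 <= u y <= 1.
    have := uw y; have := sqr_ge0 (w y); move: (u y) (w y ^+ 2) => a b b0 ab.
    by apply/andP; split; nra.
  move=> wy; exists (acos (u y)).
    rewrite acos_ge0//= acos_ltpi//; move: u1 => /andP[u1 ->]; rewrite andbT.
    rewrite lt_neqAle u1 andbT; apply/eqP => uy.
    have := uw y; case: wy => [wy|[_]]; rewrite -uy; last by lra.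
    rewrite sqrrN expr1n => /(canRL (addKr _)); rewrite addNr => /eqP.
    by rewrite sqrf_eq0 gt_eqF.
  apply: yE; first by rewrite acosK.
  rewrite sin_acos// -(uw y) addrC addKr sqrtr_sqr ger0_norm//.
  by case: wy => [/ltW//|[->]].
have wN : w (antipode x) = - w x by rewrite /w /= !mxE; ring.
have uN : u (antipode x) = - u x by rewrite /u /= !mxE; ring.
have : (0 < w x \/ w x = 0 /\ u x = 1) \/
    (0 < w (antipode x) \/ w (antipode x) = 0 /\ u (antipode x) = 1).
  rewrite wN uN oppr_gt0; case: (ltgtP 0 (w x)) => [|wx|wx].
  - by left; left.
  - by right; left.
  have /eqP : u x ^+ 2 = 1 by rewrite -(uw x) -wx expr0n addr0.
  rewrite sqrf_eq1 => /orP[]/eqP ux; first by left; right.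
  by right; right; rewrite ux opprK -wx oppr0.
case=> /upper[a api ax]; first by exists (a, false).
by exists (a, true) => //; rewrite /signed_circle /= -ax antipodeK.
Qed.

Lemma geodesic_signed_circle t (c d : R * bool) :
    0 <= c.1 < pi -> 0 <= d.1 < pi ->
  geodesic (signed_circle t c) (signed_circle t d) =
  if c.2 == d.2 then `|c.1 - d.1| else pi - `|c.1 - d.1|.
Proof.
move=> /andP[c0 cpi] /andP[d0 dpi].
have cd : `|c.1 - d.1| <= pi.
  by rewrite ler_norml; apply/andP; split; lra.
have acosE : acos (cos (c.1 - d.1)) = `|c.1 - d.1|.
  by rewrite -cos_norm cosK// in_itv/= normr_ge0.
have E : inner (val (circle (t + c.1))) (val (circle (t + d.1))) = cos (c.1 - d.1).
  by rewrite inner2 !circle0 !circle1 -cosB; congr cos; ring.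
have innerN (u v : 'rV[R]_2) : inner (- u) v = - inner u v :> R.
  by rewrite !inner2 !mxE; ring.
have innerNr (u v : 'rV[R]_2) : inner u (- v) = - inner u v :> R.
  by rewrite !inner2 !mxE; ring.
rewrite /signed_circle; case: c.2; case: d.2; rewrite ?geodesicNN /=.
- by rewrite /geodesic E.
- by rewrite /geodesic /= innerN E acosN ?acosE// cos_geN1 cos_le1.
- by rewrite /geodesic /= innerNr E acosN ?acosE// cos_geN1 cos_le1.
- by rewrite /geodesic E.
Qed.

End circle.

(** * Forms positive on point sets of small diameter *)

Lemma ex_between (R : realFieldType) (s : seq R) b :
  exists2 t, t < b & forall a, a \in s -> a < b -> a < t.
Proof.
elim: s => [|x s [t tb st]]; first by exists (b - 1); rewrite // gtrBl.
have [xb|bx] := ltP x b; last first.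
  exists t => // a; rewrite inE => /predU1P[->|]; last exact: st.
  by rewrite ltNge bx.
exists (Num.max t ((x + b) / 2)); first by rewrite gt_max tb midf_lt.
move=> a; rewrite inE lt_max => /predU1P[-> _|/st ta /ta ->//].
by rewrite midf_lt ?orbT.
Qed.

Lemma ex_first (R : realDomainType) (T : eqType) (f : T -> R)
    (P : pred T) (s : seq T) :
  (exists2 c, c \in s & P c) ->
  exists c, [/\ c \in s, P c & forall d, d \in s -> P d -> f c <= f d].
Proof.
elim: s => [[]//|x s IHs] [c0 c0s Pc0].
have [/hasP/IHs[c [cs Pc cmin]]|/hasPn nP] := boolP (has P s); last first.
  exists x; rewrite mem_head; split => //.
    by move: c0s; rewrite inE => /predU1P[<-//|/nP]; rewrite Pc0.
  by move=> d; rewrite inE => /predU1P[->//|/nP/negP].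
have [cx|xc] := leP (f c) (f x).
  exists c; rewrite inE cs orbT; split => // d.
  by rewrite inE => /predU1P[->//|]; exact: cmin.
have [Px|nPx] := boolP (P x).
  exists x; rewrite mem_head; split => // d.
  by rewrite inE => /predU1P[->//|ds Pd]; apply: le_trans (ltW xc) (cmin _ _ _).
exists c; rewrite inE cs orbT; split => // d.
by rewrite inE => /predU1P[->|]; [rewrite (negbTE nPx)|exact: cmin].
Qed.

(** In this section [A] lists points [c.1] of a half circle with a sign [c.2], where
[true] stands for the sign [-]. The hypotheses say that all the signed points
are at angle at least [delta] from the antipodes of the others. *)
Section positive_form.
Context {R : realType} (A : seq (R * bool)) (delta : R).
Context (delta0 : 0 < delta) (A0 : (0, false) \in A)
  (AI : {in A, forall c, 0 <= c.1 < pi})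
  (Asep : {in A &, forall c d, c.2 != d.2 -> delta <= `|c.1 - d.1|})
  (Asame : {in A &, forall c d, c.2 = d.2 -> `|c.1 - d.1| <= pi - delta}).

Let good (f : R -> R) (c : R * bool) := 0 < (-1) ^+ c.2 * f c.1.

(** The invariant of the sweep along the half circle: [k] roots were spent to give [f]
the right sign at all the points before [c], and [f] has the sign [(-1) ^+ k]
from [c] on, which is also the sign of [c]. *)
Let stage k f (c : R * bool) := [/\ c \in A, c.2 = odd k, k%:R * delta <= c.1,
  {in A, forall d, d.1 < c.1 -> good f d} &
  forall a, c.1 <= a < pi -> 0 < (-1) ^+ k * f a].

Let good_mul t f (c : R * bool) : 0 <= c.1 < t -> t < pi -> good f c ->
  good (fun a => sin (t - a) * f a) c.
Proof.
move=> /andP[c0 ct] tpi gc; rewrite /good mulrCA mulr_gt0//.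
by apply: sin_gt0_pi; apply/andP; split; lra.
Qed.

(** Let [d] be the first point at which [f] has the wrong sign. A new root, between
[d] and the points before it, corrects the sign at [d]. As the signs of [c] and
[d] are opposite, [d] is at least [delta] further than [c]. *)
Lemma stage_step k f c : stage k f c -> {in A, forall d, good f d} \/
  exists t d, stage k.+1 (fun a => sin (t - a) * f a) d.
Proof.
move=> [cA ck kc cgood csign].
have [[d dA]|allgood] := pselect (exists2 d, d \in A & ~~ `[< good f d >]);
    last first.
  left => d dA; apply: contrapT => dbad; apply: allgood; exists d => //.
  exact/asboolPn.
move=> dbad; right.
have [{dA dbad}d [dA /asboolPn dbad dmin]] :
    exists d, [/\ d \in A, ~~ `[< good f d >] &
      forall e, e \in A -> ~~ `[< good f e >] -> d.1 <= e.1].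
  by apply: ex_first; exists d.
have cd : c.1 <= d.1.
  by rewrite leNgt; apply/negP => dc; apply: dbad; exact: cgood.
have /andP[d0 dpi] := AI dA.
have dsign : 0 < (-1) ^+ k * f d.1 by apply: csign; rewrite cd.
have dk : d.2 = odd k.+1.
  apply/eqP; apply: contra_notT dbad => /=; rewrite /good.
  rewrite -(signr_odd _ k) in dsign.
  by case: d.2; case: (odd k) dsign.
have kd : k.+1%:R * delta <= d.1.
  have : delta <= `|c.1 - d.1| by apply: Asep => //; rewrite ck dk /=; case: odd.
  rewrite distrC ger0_norm ?subr_ge0// -natr1 mulrDl mul1r; lra.
have d_gt0 : 0 < d.1.
  by apply: lt_le_trans kd; rewrite mulr_gt0.
have [t td At] := ex_between (map fst A) d.1.
have t0 : 0 < t by apply: At => //; apply/mapP; exists (0, false).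
exists t, d; split => //.
- move=> e eA ed; have /andP[e0 _] := AI eA.
  apply: good_mul; last 1 first.
  + apply: contrapT => ebad; have := dmin e eA (introN (asboolP _) ebad).
    by rewrite leNgt ed.
  + by rewrite e0 At// map_f.
  + exact: lt_trans dpi.
- move=> a /andP[da api]; rewrite exprS mulN1r mulrCA mulNr mulrN -mulNr.
  rewrite mulr_gt0 ?csign ?api ?(le_trans cd)// -sinN opprB.
  by apply: sin_gt0_pi; apply/andP; split; lra.
Qed.

Lemma stage_or_good k :
  (exists2 f, isform k f & {in A, forall c, good f c}) \/
  (exists f c, isform k.+1 f /\ stage k.+1 f c).
Proof.
have next j f c : isform j f -> stage j f c ->
    (exists2 f, isform j f & {in A, forall c, good f c}) \/
    (exists f c, isform j.+1 f /\ stage j.+1 f c).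
  move=> jf /stage_step[gf|[t [d std]]]; first by left; exists f.
  by right; exists (fun a => sin (t - a) * f a), d; split => //; exact: isform_sin.
elim: k => [|k [[f kf gf]|[f [c [kf fc]]]]]; last exact: next fc.
  apply: (next 0%N (fun=> 1) (0, false)); first by exists 1.
  split => //=; first by rewrite mul0r.
    by move=> d /AI /andP[d0 _]; rewrite ltNge d0.
  by move=> a _; rewrite mul1r ltr01.
have [t tpi At] := ex_between (map fst A) pi.
left; exists (fun a => sin (t - a) * f a); first exact: isform_sin.
move=> c cA; have /andP[c0 cpi] := AI cA.
by apply: good_mul; rewrite ?c0 ?At ?map_f ?gf.
Qed.

(** If [m] roots were not enough, then the next point, which carries the sign [+] as
[m] is odd, would be at least [(m + 1) * delta] away from the origin. Together with
its distance at least [delta] from the antipode of the origin, this exceeds [pi]. *)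
Lemma ex_positive_form m : odd m -> pi < m.+2%:R * delta ->
  exists2 f, isform m f & {in A, forall c : R * bool, 0 < (-1) ^+ c.2 * f c.1}.
Proof.
move=> om mdelta; have [//|[f [c [_ [cA c2 mc _ _]]]]] := stage_or_good m.
have c2F : c.2 = false by rewrite c2 /= om.
have := Asame cA A0 c2F; rewrite subr0 => /(le_trans (ler_norm _)).
move: mdelta; rewrite -natr1 mulrDl mul1r; lra.
Qed.

End positive_form.

(** * The moment map of the Vietoris--Rips complex *)

Section moments.
Context {R : realType}.

Definition moment (X : choiceType) (K : simplicial_complex X) (w : X -> R)
    (p : realization R K) : R := \sum_(x \in [set: X]) p x * w x.

Lemma moment_seq (X : choiceType) (K : simplicial_complex X) (w : X -> R)
    (p : realization R K) (s : seq X) : uniq s -> closed_simplex [set` s] p ->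
  moment w p = \sum_(x <- s) p x * w x.
Proof.
move=> us sp; rewrite fsbig_seq//; apply/esym/fsbig_widen => // x [_ /= xs].
by rewrite sp ?mul0r.
Qed.

Lemma supp_closed_simplex (X : choiceType) (K : simplicial_complex X)
    (p : realization R K) : closed_simplex [set x | p x != 0] p.
Proof. by move=> x /= /negP; rewrite negbK => /eqP. Qed.

Lemma finite_uniq (X : choiceType) (s : set X) : finite_set s ->
  exists2 t : seq X, uniq t & s = [set` t].
Proof.
move=> /finite_seqP[t ->]; exists (undup t); first exact: undup_uniq.
by apply/seteqP; split => x /=; rewrite mem_undup.
Qed.

(** On each simplex this is a finite sum of continuous functions, which is all that
the weak topology asks for. *)
Lemma moment_continuous (X : choiceType) (K : simplicial_complex X) (w : X -> R) :
  continuous (@moment X K w).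
Proof.
apply/continuousP => O oO; change (realization_open (@moment X K w @^-1` O)).
move=> s Ks p sp Op.
have [t ut st] := finite_uniq (simplex_finite Ks).
have [e e0 eO] : exists2 e : R, 0 < e & forall y, `|moment w p - y| < e -> O y.
  have : nbhs (moment w p) O by exact: open_nbhs_nbhs.
  by move=> /nbhs_normP[e e0 eO]; exists e => // y ye; apply: eO.
pose W := \sum_(x <- t) `|w x|; have W0 : 0 <= W by rewrite sumr_ge0.
exists (e / (W + 1)); first by rewrite divr_gt0// ltr_wpDl.
move=> q sq pq; apply: eO; rewrite st in sp sq.
rewrite !(moment_seq _ ut)// -sumrB (le_lt_trans (ler_norm_sum _ _ _))//.
apply: (@le_lt_trans _ _ (e / (W + 1) * W)).
  rewrite mulr_sumr !big_seq; apply: ler_sum => x xt.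
  rewrite -mulrBl normrM ler_wpM2r//; apply/ltW/pq.
  by rewrite st.
by rewrite mulrAC ltr_pdivrMr ?ltr_wpDl// ltr_pM2l// ltrDl.
Qed.

Lemma moment_antipode (n : nat) (r : R) (w : sphere R n -> R)
    (p : realization R (VR_sphere n r)) :
  (forall x, w (antipode x) = - w x) ->
  moment w (VR_antipode p) = - moment w p.
Proof.
move=> wN; rewrite /moment (reindex_fsbigT antipode); last first.
  by exists antipode; exact: antipodeK.
have [s us sp] := finite_uniq (simplex_finite (coord_supp p)).
have ps : closed_simplex [set` s] p by rewrite -sp; exact: supp_closed_simplex.
transitivity (moment (fun x => - w x) p).
  by apply: eq_fsbigr => x _; rewrite /= antipodeK wN.
rewrite -[\sum_(x \in _) p x * _]/(moment w p) !(moment_seq _ us)// -sumrN.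
by apply: eq_bigr => x _; rewrite mulrN.
Qed.

Lemma moment_gt0 (X : choiceType) (K : simplicial_complex X) (w : X -> R)
    (p : realization R K) : (forall x, p x != 0 -> 0 < w x) -> 0 < moment w p.
Proof.
move=> w0; have [s us sp] := finite_uniq (simplex_finite (coord_supp p)).
have ps x : x \in s -> p x != 0.
  by move=> xs; have : [set` s] x by []; rewrite -sp.
rewrite (moment_seq _ us) -?sp; last exact: supp_closed_simplex.
have [x xs] := simplex_nonempty (coord_supp p).
have {}xs : x \in s by rewrite sp in xs.
rewrite (big_rem x)//= ltr_pwDl//.
  by rewrite mulr_gt0 ?w0 ?ps// lt_neqAle eq_sym ps//= coord_ge0.
rewrite big_seq sumr_ge0// => y /mem_rem ys.
by rewrite mulr_ge0 ?coord_ge0// ltW// w0// ps.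
Qed.

Lemma moment_sum (X : choiceType) (K : simplicial_complex X) n
    (c : 'I_n -> R) (w : 'I_n -> X -> R) (p : realization R K) :
  moment (fun x => \sum_i c i * w i x) p = \sum_i c i * moment (w i) p.
Proof.
have [s us sp] := finite_uniq (simplex_finite (coord_supp p)).
have ps : closed_simplex [set` s] p by rewrite -sp; exact: supp_closed_simplex.
under [RHS]eq_bigr do rewrite (moment_seq _ us)// mulr_sumr.
rewrite (moment_seq _ us)// exchange_big/=; apply: eq_bigr => x _.
by rewrite mulr_sumr; apply: eq_bigr => i _; rewrite mulrCA.
Qed.

End moments.

Lemma le_diam (R : realType) (n : nat) (r : R) (s : set (sphere R n))
    (x y : sphere R n) :
  simplex (VR_sphere n r) s -> s x -> s y -> geodesic x y <= r.
Proof.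
move=> [sfin _ sr] sx sy; apply: le_trans sr; apply: ub_le_sup; last first.
  by exists (x, y).
have : finite_set [set geodesic z.1 z.2 | z in s `*` s].
  by apply: finite_image; exact: finite_setX.
move=> /finite_seqP[t ->]; exists (\sum_(z <- t) `|z|) => z /= zt.
rewrite (big_rem z)//= (le_trans (ler_norm z))// lerDl.
by rewrite sumr_ge0.
Qed.

Definition monomial (R : realType) n (i : nat) (x : sphere R 1) : R :=
  val x 0 0 ^+ (n - i) * val x 0 1 ^+ i.

Lemma monomialN (R : realType) n i (x : sphere R 1) : odd n -> (i <= n)%N ->
  monomial n i (antipode x) = - monomial n i x.
Proof.
move=> on ni; rewrite /monomial /= !mxE.
rewrite (exprNn (val x 0 0)) (exprNn (val x 0 1)) mulrACA -exprD.
by rewrite subnK// -signr_odd on mulN1r.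
Qed.

Lemma form_of_poly_circle (R : realType) n (p : {poly R}) a :
  form_of_poly n p a = \sum_(i < n.+1) p`_i * monomial n i (circle a).
Proof.
by apply: eq_bigr => i _; rewrite /monomial circle0 circle1 mulrA.
Qed.

(** The half circle starts at a vertex [x0] of the simplex, whose signed angle [0] is
the origin required by [ex_positive_form], with [delta = pi - r]. The form
has odd degree, so having the sign of a point at its representative in the half
circle means being positive at the point itself. *)
Lemma VR_circle_positive (R : realType) (m : nat) (r : R)
    (s : set (sphere R 1)) : odd m -> r < pi * m.+1%:R / m.+2%:R ->
    simplex (VR_sphere 1 r) s ->
  exists c : 'I_m.+1 -> R, forall x, s x -> 0 < \sum_i c i * monomial m i x.
Proof.
move=> om rm Ks.
have [t ut st] := finite_uniq (simplex_finite Ks).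
have [x0 sx0] := simplex_nonempty Ks.
have [[a0 b0] /= _ x0E] := signed_circle_surj 0 x0.
pose theta := if b0 then a0 + pi else a0.
have {}x0E : x0 = signed_circle theta (0, false).
  rewrite x0E /signed_circle /= add0r addr0 /theta.
  by case: b0 {x0E theta}; rewrite ?circleDpi.
pose g x := xget (0, false) [set c | 0 <= c.1 < pi /\ x = signed_circle theta c].
have gP x : 0 <= (g x).1 < pi /\ x = signed_circle theta (g x).
  have [c cpi xc] := signed_circle_surj theta x.
  by rewrite /g; case: xgetP => [? ->//|/(_ c)]; case.
pose delta := pi - r; pose A := (0, false) :: map g t.
have AP c : c \in A -> 0 <= c.1 < pi /\ s (signed_circle theta c).
  rewrite inE => /predU1P[->|/mapP[x xt ->]].
    by rewrite /= lexx pi_gt0 -x0E.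
  by have [gx <-] := gP x; rewrite gx st.
have dist c d : c \in A -> d \in A ->
    (if c.2 == d.2 then `|c.1 - d.1| else pi - `|c.1 - d.1|) <= r.
  move=> /AP[cI cs] /AP[dI ds]; rewrite -(geodesic_signed_circle theta)//.
  exact: le_diam cs ds.
have m0 : 0 < m.+2%:R :> R by [].
have [] := @ex_positive_form R A delta _ _ _ _ _ m om.
- rewrite /delta subr_gt0 (lt_trans rm)// -mulrA gtr_pMr ?pi_gt0//.
  by rewrite ltr_pdivrMr// mul1r ltr_nat.
- exact: mem_head.
- by move=> c /AP[].
- by move=> c d cA dA /negbTE cd; have := dist c d cA dA; rewrite cd /delta; lra.
- by move=> c d cA dA cd; have := dist c d cA dA; rewrite cd eqxx /delta; lra.
- rewrite /delta; move: rm; rewrite ltr_pdivlMr// => rm.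
  by move: rm; rewrite -[m.+2%:R]natr1; lra.
move=> f mf fA; have [p _ pE] := isform_poly (isform_shift (- theta) mf).
exists (fun i => p`_i) => x sx.
have [gx xE] := gP x.
have gA : g x \in A by rewrite inE map_f ?orbT//; rewrite st in sx.
have circleE a : \sum_(i < m.+1) p`_i * monomial m i (circle (theta + a)) = f a.
  by rewrite -form_of_poly_circle -pE addrC addKr.
rewrite xE /signed_circle; have := fA _ gA; case: (g x).2 => /=.
  rewrite mulN1r -circleE -sumrN; congr (_ < _); apply: eq_bigr => i _.
  by rewrite monomialN ?leq_ord// mulrN.
by rewrite mul1r circleE.
Qed.

Lemma odd_map_lower_bound (R : realType) (m k : nat) (r : R)
    (f : sphere R k -> realization R (VR_sphere 1 r)) :
    odd m -> (m < k)%N -> odd_map antipode (@VR_antipode R 1 r) f ->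
  pi * m.+1%:R / m.+2%:R <= r.
Proof.
move=> om mk [fc fN]; rewrite leNgt; apply/negP => rm.
pose g (i : 'I_m.+1) x := moment (monomial m i) (f x).
have [|i|i x|x gx] := @borsuk_ulam R k m.+1 g.
- exact: mk.
- move=> x; apply: continuous_comp; [exact: fc|exact: moment_continuous].
- by rewrite /g fN moment_antipode// => y; apply: monomialN; rewrite ?leq_ord.
have [c cP] := VR_circle_positive om rm (coord_supp (f x)).
have : 0 < moment (fun x => \sum_i c i * monomial m i x) (f x).
  by apply: moment_gt0 => y /cP.
rewrite moment_sum big1 ?ltxx// => i _.
by have := gx i; rewrite /g => ->; rewrite mulr0.
Qed.

(** * Forms near their maximum *)

Lemma cos_pi_nat (R : realType) j : cos (j%:R * pi) = (-1) ^+ j :> R.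
Proof.
elim: j => [|j IHj]; first by rewrite mul0r cos0.
by rewrite -natr1 mulrDl mul1r cosDpi IHj exprS mulN1r.
Qed.

(** Indices of grid points at which a comparison function of period [2 * K], shifted
to start at [A - 1], is evaluated: after [A - 1], [A] and [B], which lie within
the first half period, come the ends of all the half periods. *)
Section sample_points.
Context (A B K : nat) (A0 : (0 < A)%N) (AB : (A < B)%N) (BK : (B + 2 <= A + K)%N).

Definition sample j :=
  match j with 0 => A.-1 | 1 => A | 2 => B | j'.+3 => (A.-1 + j'.+1 * K)%N end.

Lemma sample_ltn j : (sample j < sample j.+1)%N.
Proof.
case: j => [|[|[|j]]]; rewrite /sample.
- by rewrite prednK.
- by [].
- lia.
by rewrite ltn_add2l ltn_mul2r ltnSn andbT; lia.
Qed.

Lemma sample_ge j : (A.-1 <= sample j)%N.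
Proof. by case: j => [|[|[|j]]]; rewrite /sample ?leq_addr//; lia. Qed.

Lemma sample_lt n j : (0 < n -> j <= n.+1 -> sample j < A.-1 + n * K)%N.
Proof.
move=> n0 jn; have nK : (1 * K <= n * K)%N by rewrite leq_mul2r n0 orbT.
case: j jn => [|[|[|j]]] jn; rewrite /sample; [lia..|].
have : (j.+2 * K <= n * K)%N by rewrite leq_mul2r -ltnS jn orbT.
by rewrite (mulSn j.+1); lia.
Qed.

End sample_points.

(** A quantitative version of M. Riesz's lemma on the oscillation of trigonometric
polynomials: [f] cannot descend from more than [kappa * M] to less than
[- kappa * M] within an angle of at most [pi / n - 2 * h]. Otherwise subtract [f] from
[M' * cos (n * (a - t))], where [t] is the grid point before the descent. The
descent takes place inside the first half period of this cosine and is
steeper, which yields two sign changes more than the one of the cosine there. At the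
ends of the half periods the cosine dominates [f]; since these are grid points,
[f] only has to be bounded by [M] on the grid. In total there are [n + 1] sign
changes in a half circle. *)
Lemma form_oscillation (R : realType) (n K A B : nat) (f : R -> R) (M kappa : R) :
    let h := pi / (n * K)%:R in
    (0 < n)%N -> (3 <= K)%N -> isform n f -> 0 < M -> cos (pi / K%:R) < kappa ->
    (forall i : nat, `|f (i%:R * h)| <= M) ->
    (0 < A < B)%N -> (B + 2 <= A + K)%N ->
    kappa * M < f (A%:R * h) -> f (B%:R * h) < - (kappa * M) ->
  False.
Proof.
move=> h n0 K3 nf M0; set rho := cos _ => rkappa fM /andP[A0 AB] BK fA fB.
have K1 : (0 < K)%N by apply: leq_trans K3.
have K0 : 0 < K%:R :> R by rewrite ltr0n.
have nR0 : 0 < n%:R :> R by rewrite ltr0n.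
have h0 : 0 < h by rewrite divr_gt0 ?pi_gt0// ltr0n muln_gt0 n0.
have nh : n%:R * h = pi / K%:R.
  by rewrite /h natrM; field; rewrite !gt_eqF.
have piK : 0 < (pi : R) / K%:R < pi / 2.
  by rewrite divr_gt0 ?pi_gt0//= ltr_pM2l ?pi_gt0// ltf_pV2 ?posrE// ltr_nat.
have rho0 : 0 < rho.
  apply: cos_gt0_pihalf; case/andP: piK => p1 ->; rewrite andbT.
  by apply: lt_trans p1; rewrite oppr_lt0 divr_gt0 ?pi_gt0.
(* [M'] exceeds [M], to make the signs at the ends of the half periods strict, but
   is small enough to have [M' * cos (n * h) = kappa * M]. *)
pose t := (A.-1)%:R * h; pose M' := M * kappa / rho.
have M'rho : M' * rho = kappa * M by rewrite /M'; field; rewrite gt_eqF.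
have MM' : M < M' by rewrite /M' ltr_pdivlMr// ltr_pM2l.
have M'0 : 0 < M' := lt_trans M0 MM'.
pose D a := M' * cos (n%:R * (a - t)) - f a.
have nD : isform n D.
  have := isformD (isformZ M' (isform_shift (- t) (isform_sincos n).1))
                  (isformZ (-1) nf).
  by congr (isform n _); apply/funext => a; rewrite mulN1r.
pose N := sample A B K.
have NS j : (N j < N j.+1)%N by exact: sample_ltn.
have NA j : (A.-1 <= N j)%N by exact: sample_ge.
have DN j : D ((N j)%:R * h) =
    M' * cos ((N j - A.-1)%:R * (pi / K%:R)) - f ((N j)%:R * h).
  by rewrite /D /t natrB// -nh; congr (M' * cos _ - _); ring.
apply: (@form_sign_changes R n D (t - h / 2) (fun j => (N j)%:R * h) nD).
- by move=> j _; rewrite ltr_pM2r// ltr_nat.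
- move=> j jn; apply/andP; split.
    have : t <= (N j)%:R * h by rewrite ler_pM2r// ler_nat.
    lra.
  have Nn : (N j < A.-1 + n * K)%N by exact: sample_lt.
  have {Nn} : ((N j)%:R + 1) * h <= ((A.-1)%:R + (n * K)%:R) * h.
    by rewrite ler_pM2r// natr1 -natrD ler_nat.
  have -> : ((A.-1)%:R + (n * K)%:R) * h = t + pi.
    by rewrite mulrDl /h [(n * K)%:R * _]mulrC divfK// pnatr_eq0 -lt0n muln_gt0 n0.
  rewrite mulrDl mul1r; lra.
move=> j jn; have := fM (N j); rewrite ler_norml => /andP[fN1 fN2].
rewrite DN; case: j jn fN1 fN2 => [|[|[|j]]] jn fN1 fN2.
- by rewrite /= subnn mul0r cos0 mulr1 mul1r; lra.
- have -> : (N 1%N - A.-1 = 1)%N by rewrite /N /= -[A in LHS]prednK// subSnn.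
  by rewrite mul1r expr1 mulN1r -/rho M'rho /=; lra.
- rewrite sqrrN expr1n mul1r.
  have : - rho <= cos ((N 2%N - A.-1)%:R * (pi / K%:R)).
    have -> : - rho = cos (pi - pi / K%:R).
      by rewrite addrC cosDpi cosN.
    have NK : (N 2%N - A.-1 <= K.-1)%N.
      by rewrite leq_subLR /N /=; clear -A0 BK K1; lia.
    have KE : pi - pi / K%:R = K.-1%:R * (pi / K%:R) :> R.
      have KK : K%:R = K.-1%:R + 1 :> R by rewrite natr1 prednK.
      by move: K0; rewrite KK => K0; field; rewrite gt_eqF.
    case/andP: piK => p1 p2; have p3 := pi_gt0 R.
    have N0 : 0 <= (N 2%N - A.-1)%:R * ((pi : R) / K%:R) by rewrite mulr_ge0// ltW.
    have Npi : (N 2%N - A.-1)%:R * ((pi : R) / K%:R) <= pi - pi / K%:R.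
      by rewrite KE ler_pM2r// ler_nat.
    rewrite leNgt ltr_cos ?in_itv/= -?leNgt// ?N0/=; lra.
  move=> /(ler_wpM2l (ltW M'0)); rewrite mulrN M'rho /=; lra.
- have -> : (N j.+3 - A.-1)%:R * (pi / K%:R) = j.+1%:R * pi :> R.
    rewrite /= addKn natrM; field; by rewrite gt_eqF.
  rewrite cos_pi_nat; have -> : (-1) ^+ j.+3 = (-1) ^+ j.+1 :> R.
    by rewrite -[j.+3]addn2 exprD sqrrN expr1n mulr1.
  rewrite -signr_odd; case: odd => /=; rewrite ?expr1 ?expr0 ?mulN1r ?mul1r; lra.
Qed.

(** * Maps into a realization with finitely many vertices *)

(** Near [v0] the point [f v] may lie in several simplices, but only in finitely many
as [G] is finite. If its support is [S B], then for [v] near [v0] this set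
contains the support of [f v0], so that openness can be tested in the one closed
simplex on [S B], which contains both points. *)
Lemma realization_continuous (R : realType) (T : topologicalType)
    (X : choiceType) (K : simplicial_complex X) (G : seq X)
    (f : T -> realization R K) :
    (forall v x, x \notin G -> f v x = 0) ->
    (forall x, continuous (fun v => f v x)) ->
  continuous f.
Proof.
move=> fG fc v0 U; rewrite nbhsE => -[Q [oQ Qv0] QU].
have {}oQ : realization_open Q := oQ.
suff : \forall v \near v0, Q (f v) by apply: filterS => v /QU.
pose g (i : 'I_(size G)) := tnth (in_tuple G) i.
pose S (B : {set 'I_(size G)}) : set X := [set x | exists2 i, i \in B & g i = x].
have gP x : x \in G -> exists i, g i = x.
  by move=> /(tnthP (in_tuple G))[i ->]; exists i.
have coord_near x e : 0 < e -> \forall v \near v0, `|f v0 x - f v x| < e.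
  move=> e0; have /cvgrPdist_lt := fc x v0; exact.
have near_B (B : {set 'I_(size G)}) :
    \forall v \near v0, [set x | f v x != 0] = S B -> Q (f v).
  have [KB|nKB] := pselect (simplex K (S B)); last first.
    by apply: nearW => v vB; exfalso; apply: nKB; rewrite -vB; exact: coord_supp.
  have [v0B|] := pselect (closed_simplex (S B) (f v0)).
    have [e e0 eQ] := oQ _ KB _ v0B Qv0.
    have : \forall v \near v0, forall i, `|f v0 (g i) - f v (g i)| < e.
      by apply: filter_forall => i; exact: coord_near.
    apply: filterS => v ve vB; apply: eQ.
      by rewrite -vB => x /= /negP; rewrite negbK => /eqP.
    by move=> _ [i _ <-]; exact: ve.
  move=> /existsNP[x /not_implyP[xB /eqP x0]].
  have : \forall v \near v0, `|f v0 x - f v x| < `|f v0 x|.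
    by apply: coord_near; rewrite normr_gt0.
  apply: filterS => v vx vB; exfalso; apply: xB; rewrite -vB /=.
  by apply: contraTneq vx => ->; rewrite subr0 ltxx.
have : \forall v \near v0, forall B, [set x | f v x != 0] = S B -> Q (f v).
  exact: filter_forall.
apply: filterS => v /(_ [set i | f v (g i) != 0]%SET); apply.
apply/seteqP; split => [x /= fx|_ [i + <-]]; last by rewrite inE.
have [|i ix] := gP x; first by apply: contraR fx => /fG ->.
by exists i; rewrite ?inE ix.
Qed.

Lemma bigmax_attained (R : realDomainType) (T : eqType) (s : seq T) (g : T -> R) :
  \big[Num.max/0]_(x <- s) g x = 0 \/
  exists2 x, x \in s & \big[Num.max/0]_(x <- s) g x = g x.
Proof.
elim: s => [|x s IHs]; first by left; rewrite big_nil.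
rewrite big_cons; set m := \big[_/_]_(_ <- _) _ in IHs *.
have [mx|xm] := leP m (g x).
  by right; exists x; rewrite ?mem_head.
case: IHs => [|[y ys ->]]; first by left.
by right; exists y; rewrite // inE ys orbT.
Qed.

(** * Odd maps into the Vietoris--Rips complex of the circle *)

(** In this section [h] is the step of the grid [G] of the circle, [F v] the form of
degree [n] with coefficients [v], [Max v] its maximum on the grid, and [wt v] the
weight that the form puts on the points of the grid where it is close to its
maximum. *)
Section construction.
Context {R : realType} (n k K : nat) (r kappa : R).
Context (n0 : (0 < n)%N) (on : odd n) (kn : (k <= n)%N) (K3 : (3 < K)%N).
Let h : R := pi / (n * K)%:R.
Context (kappa0 : 0 < kappa) (kappa1 : kappa < 1) (rkappa : cos (pi / K%:R) < kappa).
Context (rh : pi - r <= (K%:R - 2) * h).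

Let K0 : (0 < K)%N. Proof. by apply: leq_trans K3. Qed.

Let nK0 : 0 < (n * K)%:R :> R.
Proof. by rewrite ltr0n muln_gt0 n0. Qed.

Let h0 : 0 < h. Proof. by rewrite divr_gt0// pi_gt0. Qed.

Let nKh : (n * K)%:R * h = pi.
Proof. by rewrite mulrC divfK// gt_eqF. Qed.

Let point (i : nat) : sphere R 1 := circle (i%:R * h).

Let pointD i : point (i + n * K) = antipode (point i).
Proof. by rewrite /point natrD mulrDl nKh circleDpi. Qed.

Let pointD2 i j : point (i + j * (n * K).*2) = point i.
Proof.
elim: j => [|j IHj]; first by rewrite addn0.
have -> : (i + j.+1 * (n * K).*2 = i + j * (n * K).*2 + n * K + n * K)%N.
  by rewrite mulSn -addnn; ring.
by rewrite !pointD antipodeK.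
Qed.

Let G : seq (sphere R 1) := undup (map point (iota 0 (n * K).*2)).

Let nK_gt0 : (0 < (n * K).*2)%N.
Proof. by rewrite double_gt0 muln_gt0 n0. Qed.

Let point_G i : point i \in G.
Proof.
rewrite (divn_eq i (n * K).*2) addnC pointD2 mem_undup; apply: map_f.
by rewrite mem_iota add0n ltn_mod.
Qed.

Let G_point x : x \in G -> exists2 i, (i < (n * K).*2)%N & x = point i.
Proof.
by rewrite mem_undup => /mapP[i]; rewrite mem_iota => /andP[_ ik] ->; exists i.
Qed.

Let G_antipode x : (antipode x \in G) = (x \in G).
Proof.
suff GN y : y \in G -> antipode y \in G.
  by apply/idP/idP => [/GN|/GN//]; rewrite antipodeK.
by move=> /G_point[i _ ->]; rewrite -pointD.
Qed.

Let F (v : 'rV[R]_k.+1) (x : sphere R 1) : R :=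
  \sum_(i < k.+1) v 0 i * monomial n i x.

Let F_circle v a : F v (circle a) = form_of_poly n (rVpoly v) a.
Proof.
rewrite form_of_poly_circle /F.
under eq_bigr => i _ do rewrite -coef_rVpoly_ord.
rewrite (big_ord_widen n.+1
  (fun i => (rVpoly v)`_i * monomial n i (circle a)) (kn : k.+1 <= n.+1)%N).
rewrite big_mkcond; apply: eq_bigr => i _; case: ltnP => // ki.
by rewrite nth_default ?mul0r// (leq_trans _ ki)// size_poly.
Qed.

Let F_form v : isform n (fun a => F v (circle a)).
Proof.
have := isform_of_poly n (rVpoly v).
by congr (isform n _); apply/funext => a; rewrite F_circle.
Qed.

Let F_antipode v x : F v (antipode x) = - F v x.
Proof.
rewrite /F -sumrN; apply: eq_bigr => i _.
by rewrite monomialN ?mulrN// (leq_trans _ kn)// -ltnS.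
Qed.

Let F_opp v x : F (- v) x = - F v x.
Proof. by rewrite /F -sumrN; apply: eq_bigr => i _; rewrite mxE mulNr. Qed.

Let F_continuous x : continuous (fun v => F v x).
Proof.
apply: continuous_big => [|i _ v]; first exact: add_continuous.
apply: (@continuousM _ _ (fun v : 'rV[R]_k.+1 => v 0 i) (fun=> monomial n i x)).
  exact: coord_continuous.
exact: cst_continuous.
Qed.

Let Max v : R := \big[Num.max/0]_(x <- G) F v x.

Let Max_continuous : continuous Max.
Proof.
by apply: continuous_big => [|x _]; [exact: max_continuous|exact: F_continuous].
Qed.

Let F_le_Max v x : x \in G -> `|F v x| <= Max v.
Proof.
move=> xG; rewrite ler_norml; apply/andP; split; last exact: le_bigmax_seq.
by rewrite lerNl -F_antipode; apply: le_bigmax_seq; rewrite ?G_antipode.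
Qed.

Let Max_ge0 v : 0 <= Max v.
Proof. exact: le_trans (F_le_Max v (point_G 0)). Qed.

Let MaxN v : Max (- v) = Max v.
Proof.
have le u : Max (- u) <= Max u.
  have [|[x xG]] := bigmax_attained G (F (- u)); rewrite -/(Max _) => ->.
    exact: Max_ge0.
  by rewrite F_opp (le_trans (ler_norm _))// normrN F_le_Max.
by apply/le_anti; rewrite le -{1}[v]opprK le.
Qed.

(** A form vanishing on the grid has [n + 1] zeros already among the first grid points,
where the tangent is defined and injective. *)
Let Max_gt0 v : v != 0 -> 0 < Max v.
Proof.
move=> v0; rewrite lt_neqAle Max_ge0 andbT eq_sym; apply: contra v0 => /eqP M0.
have piK : 0 < (pi : R) / K%:R < pi / 2.
  rewrite divr_gt0 ?pi_gt0 ?ltr0n//= ltr_pM2l ?pi_gt0//.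
  by rewrite ltf_pV2 ?posrE ?ltr0n// ltr_nat (leq_trans _ K3).
have ih i : (i <= n)%N -> - (pi / 2) < i%:R * h < pi / 2.
  move=> ni; have := pi_gt0 R; have ih0 : 0 <= i%:R * h by rewrite mulr_ge0// ltW.
  have : i%:R * h <= n%:R * h by rewrite ler_pM2r// ler_nat.
  have -> : n%:R * h = pi / K%:R.
    by rewrite /h natrM; field; rewrite !pnatr_eq0 -!lt0n n0 K0.
  by case/andP: piK => _; set q := _ / K%:R; move=> *; apply/andP; split; lra.
have cosih i : (i <= n)%N -> cos (i%:R * h) != 0.
  by move=> /ih /cos_gt0_pihalf /lt0r_neq0.
apply/eqP; rewrite -[v]rVpolyK; suff -> : rVpoly v = 0 by rewrite linear0.
apply/eqP; apply/negP => /negP p0.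
pose rs : seq R := [seq tan (i%:R * h) | i <- iota 0 n.+1].
have : (size rs < size (rVpoly v))%N.
  apply: max_poly_roots => //.
    apply/allP => _ /mapP[i + ->]; rewrite mem_iota ltnS => /andP[_ ni].
    have := F_le_Max v (point_G i); rewrite M0 normr_le0 F_circle.
    rewrite form_of_poly_tan ?cosih//; last by rewrite (leq_trans (size_poly _ _)).
    by rewrite mulf_eq0 expf_eq0 (negbTE (cosih i ni)) andbF.
  rewrite map_inj_in_uniq ?iota_uniq// => i j; rewrite !mem_iota !ltnS /= => ni nj.
  have lt_tan u w : (u < w <= n)%N -> tan (u%:R * h) < tan (w%:R * h).
    move=> /andP[uw wn]; rewrite ltr_tan ?in_itv/= ?ih//; last first.
      exact: leq_trans (ltnW uw) wn.
    by rewrite ltr_pM2r// ltr_nat.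
  by have [ij|ji|//] := ltngtP i j => tij; [have := lt_tan i j|have := lt_tan j i];
    rewrite tij ltxx ?ij ?ji ?ni ?nj => /(_ isT).
by rewrite size_map size_iota ltnNge (leq_trans (size_poly _ _)) ?(leq_trans kn).
Qed.

Let wt v x : R := if x \in G then Num.max 0 (F v x - kappa * Max v) else 0.
Let W v : R := \sum_(x <- G) wt v x.

Let wt_ge0 v x : 0 <= wt v x.
Proof. by rewrite /wt; case: ifP => // _; rewrite le_max lexx. Qed.

Let wt_continuous x : continuous (fun v => wt v x).
Proof.
rewrite /wt; case: (x \in G); last by move=> v; exact: cst_continuous.
move=> v; apply: (@continuous_max _ _ (fun=> 0) (fun v => F v x - kappa * Max v)).
  exact: cst_continuous.
apply: continuousB; first exact: F_continuous.
apply: (@continuousM _ _ (fun=> kappa) Max); first exact: cst_continuous.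
exact: Max_continuous.
Qed.

Let W_continuous : continuous W.
Proof.
by apply: continuous_big => [|x _]; [exact: add_continuous|exact: wt_continuous].
Qed.

Let wt_opp v x : wt (- v) x = wt v (antipode x).
Proof. by rewrite /wt G_antipode MaxN F_opp F_antipode. Qed.

Let W_opp v : W (- v) = W v.
Proof.
rewrite /W; under eq_bigr do rewrite wt_opp.
rewrite -(big_map antipode xpredT (wt v)); apply: perm_big; apply: uniq_perm.
- by rewrite map_inj_uniq ?undup_uniq//; apply: inv_inj; exact: antipodeK.
- exact: undup_uniq.
move=> x; rewrite -G_antipode -[in LHS](antipodeK x) mem_map//.
by apply: inv_inj; exact: antipodeK.
Qed.

Let W_gt0 v : v != 0 -> 0 < W v.
Proof.
move=> v0; have M0 := Max_gt0 v0.
have [M00|[x xG Mx]] := bigmax_attained G (F v).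
  by move: M0; rewrite /Max M00 ltxx.
rewrite /W (big_rem x)//= ltr_pwDl ?sumr_ge0// /wt xG -Mx -/(Max v) lt_max.
by rewrite subr_gt0 gtr_pMl ?kappa1 ?orbT.
Qed.

Let wt_supp v x : wt v x != 0 -> x \in G /\ kappa * Max v < F v x.
Proof.
rewrite /wt; case: ifP; rewrite ?eqxx// => _; rewrite maxEle subr_ge0.
by rewrite -subr_gt0 lt_neqAle eq_sym; case: ifP => [+ ->|]; rewrite ?eqxx ?subr_ge0.
Qed.

(** Were [x] and [y] at distance more than [r], then the antipode of [y] would be at
angle less than [pi - r] from [x], and the form would descend too fast between
the two. If the antipode of [y] comes before [x], apply this to the form [- v]
and exchange the two points. Indices are shifted by a full turn to make them
positive. *)
Let wt_dist v x y : v != 0 -> wt v x != 0 -> wt v y != 0 -> geodesic x y <= r.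
Proof.
move=> v0 /wt_supp[/G_point[i iN ->] Fi] /wt_supp[/G_point[j jN ->] Fj].
wlog ij : i j iN jN Fi Fj / (j <= i)%N.
  move=> wl; have [|ji] := leqP j i; first exact: wl.
  rewrite (_ : geodesic _ _ = geodesic (point j) (point i)); last first.
    by rewrite !geodesic_circle -cosN opprB.
  by apply: wl => //; exact: ltnW.
rewrite leNgt; apply/negP => rij; set m := (n * K)%N.
have m0 : (0 < m)%N by rewrite muln_gt0 n0.
have shift a : point (a + m.*2) = point a by rewrite -(pointD2 a 1) mul1n.
have ih_lt : i%:R * h < pi + pi.
  by rewrite -nKh -mulrDl ltr_pM2r// -natrD ltr_nat addnn.
have jh0 : 0 <= j%:R * h by rewrite mulr_ge0// ltW.
have ijh : j%:R * h <= i%:R * h by rewrite ler_pM2r// ler_nat.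
have gap a b : a%:R * h - b%:R * h < pi - r -> (a + 2 <= b + K)%N.
  move=> abr; have : (a%:R - b%:R) * h < (K%:R - 2) * h.
    by rewrite mulrBl; apply: lt_le_trans rh.
  rewrite ltr_pM2r// ltrBlDr addrAC ltrBrDr -!natrD ltr_nat addnC => /ltnW.
  by rewrite [(K + b)%N]addnC [(2 + a)%N]addnC.
rewrite geodesic_circle in rij.
have [im|mi|im] := ltngtP i (j + m)%N.
- have ih_pi : i%:R * h - j%:R * h <= pi.
    by rewrite lerBlDl -nKh -mulrDl -natrD ler_pM2r// ler_nat ltnW.
  rewrite cosK ?in_itv/= ?subr_ge0 ?ijh// in rij.
  apply: (@form_oscillation R n K (i + m.*2) (j + m + m.*2) _ (Max v) kappa
    n0 _ (F_form v) (Max_gt0 v0) rkappa (fun a => F_le_Max v (point_G a))).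
  + exact: ltnW.
  + by rewrite addn_gt0 double_gt0 m0 orbT ltn_add2r.
  + have /gap : (j + m)%:R * h - i%:R * h < pi - r by rewrite natrD mulrDl nKh; lra.
    by rewrite -(leq_add2r m.*2) addnAC [leqRHS]addnAC.
  + by rewrite -/h -/(point _) shift.
  + by rewrite -/h -/(point _) shift pointD F_antipode ltrN2.
- have ih_pi : pi <= i%:R * h - j%:R * h.
    by rewrite lerBrDl -nKh -mulrDl -natrD ler_pM2r// ler_nat ltnW.
  have ij2 : cos (i%:R * h - j%:R * h) = cos (pi + pi - (i%:R * h - j%:R * h)).
    by rewrite [in RHS]addrC -mulr2n cosD2pi cosN.
  rewrite ij2 cosK ?in_itv/= in rij; last by apply/andP; split; lra.
  apply: (@form_oscillation R n K (j + m + m.*2) (i + m.*2) _ (Max (- v)) kappa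
    n0 _ (F_form (- v)) (Max_gt0 _) rkappa (fun a => F_le_Max (- v) (point_G a))).
  + exact: ltnW.
  + by rewrite oppr_eq0.
  + by rewrite addn_gt0 double_gt0 m0 orbT ltn_add2r.
  + have /gap : i%:R * h - (j + m)%:R * h < pi - r by rewrite natrD mulrDl nKh; lra.
    by rewrite -(leq_add2r m.*2) addnAC [leqRHS]addnAC.
  + by rewrite -/h -/(point _) shift pointD F_antipode F_opp opprK MaxN.
  + by rewrite -/h -/(point _) shift F_opp MaxN ltrN2.
move: Fi; rewrite im pointD F_antipode.
by have := mulr_gt0 kappa0 (Max_gt0 v0); lra.
Qed.

Let wt_simplex v : v != 0 -> simplex (VR_sphere 1 r) [set x | wt v x / W v != 0].
Proof.
move=> v0; have W0 := W_gt0 v0.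
have suppE x : (wt v x / W v != 0) = (wt v x != 0).
  by rewrite mulf_eq0 invr_eq0 (gt_eqF W0) orbF.
have [x0 x0G x0wt] : exists2 x, x \in G & wt v x != 0.
  apply: contrapT => wt0; move: W0; rewrite /W big_seq big1 ?ltxx// => x xG.
  by apply/eqP; apply: contrapT => /negP wx; apply: wt0; exists x.
split.
- apply: (@sub_finite_set _ _ [set` G]) => [x /=|]; last exact: finite_seq.
  by rewrite suppE => /wt_supp[].
- by exists x0; rewrite /= suppE.
apply: ge_sup; first by exists (geodesic x0 x0), (x0, x0); rewrite //= suppE.
by move=> _ [[x y] [/= + +] <-]; rewrite !suppE; exact: wt_dist.
Qed.

Let wt_sum v : v != 0 -> \sum_(x \in [set: sphere R 1]) wt v x / W v = 1.
Proof.
move=> v0; rewrite -(fsbig_widen [set` G])//; last first.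
  by move=> x [_ /= /negP xG]; rewrite /wt (negbTE xG) mul0r.
by rewrite -fsbig_seq ?undup_uniq// -mulr_suml mulfV// gt_eqF ?W_gt0.
Qed.

Let sphere_neq0 (v : sphere R k) : val v != 0.
Proof.
apply/eqP => v0; have := set_mem (valP v); rewrite /sphere/= v0 /eucl_norm.
rewrite /inner big1 ?sqrtr0 => [/esym/eqP|i _]; last by rewrite mxE mul0r.
by rewrite oner_eq0.
Qed.

Let near_max (v : sphere R k) : realization R (VR_sphere 1 r) :=
  @Realization R _ (VR_sphere 1 r) (fun x => wt (val v) x / W (val v))
    (fun x => divr_ge0 (wt_ge0 (val v) x) (ltW (W_gt0 (sphere_neq0 v))))
    (wt_simplex (sphere_neq0 v)) (wt_sum (sphere_neq0 v)).

Lemma ex_odd_map_near_max :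
  exists f : sphere R k -> realization R (VR_sphere 1 r),
    odd_map antipode (@VR_antipode R 1 r) f.
Proof.
exists near_max; split; last first.
  move=> v; apply: realization_eq => x.
  by rewrite /= wt_opp W_opp.
apply: (@realization_continuous _ _ _ _ G) => [v x xG|x v] /=.
  by rewrite /wt (negbTE xG) mul0r.
have vc : {for v, continuous (fun u : sphere R k => val u)}.
  exact: initial_continuous.
have wtc : {for v, continuous (fun u : sphere R k => wt (val u) x)}.
  exact: (continuous_comp vc (@wt_continuous x (val v))).
have Wc : {for v, continuous (fun u : sphere R k => (W (val u))^-1)}.
  apply: continuousV; first by rewrite gt_eqF ?W_gt0.
  exact: (continuous_comp vc (@W_continuous (val v))).
exact: (continuousM wtc Wc).
Qed.

End construction.

(** The grid step [pi / (n * K)] has to satisfy [pi - r <= pi / n - 2 * h]. *)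
Lemma ex_odd_map_circle (R : realType) (n k : nat) (r : R) :
    odd n -> (k <= n)%N -> pi - pi / n%:R < r ->
  exists f : sphere R k -> realization R (VR_sphere 1 r),
    odd_map antipode (@VR_antipode R 1 r) f.
Proof.
move=> on kn nr; have n0 : (0 < n)%N by case: n on {kn nr}.
have nR0 : 0 < n%:R :> R by rewrite ltr0n.
have piR := pi_gt0 R.
pose e : R := r - (pi - pi / n%:R); have e0 : 0 < e by rewrite subr_gt0.
pose x : R := 2 * pi / (n%:R * e); have x0 : 0 <= x.
  by rewrite divr_ge0 ?mulr_ge0// ltW.
pose K := (Num.bound x + 4)%N.
have K3 : (3 < K)%N by rewrite /K addnS ltnS leq_addl.
have KR0 : 0 < K%:R :> R by rewrite ltr0n (leq_trans _ K3).
have xK : x < K%:R.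
  by apply: lt_le_trans (archi_boundP x0) _; rewrite ler_nat leq_addr.
have piK : 0 < (pi : R) / K%:R < pi / 2.
  by rewrite divr_gt0//= ltr_pM2l// ltf_pV2 ?posrE// ltr_nat (leq_trans _ K3).
have rho0 : 0 < cos (pi / K%:R) :> R.
  by apply: cos_gt0_pihalf; case/andP: piK => p1 ->; rewrite andbT; lra.
have rho1 : cos (pi / K%:R) < 1 :> R.
  case/andP: piK => p1 p2.
  rewrite -[ltRHS]cos0 ltr_cos ?in_itv/= ?lexx ?(ltW p1) ?(ltW piR)//=; lra.
apply: (@ex_odd_map_near_max R n k K r ((1 + cos (pi / K%:R)) / 2)) => //.
- by rewrite divr_gt0// addr_gt0.
- by rewrite ltr_pdivrMr// mul1r; lra.
- by rewrite ltr_pdivlMr//; lra.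
have -> : (K%:R - 2) * (pi / (n * K)%:R) = pi / n%:R - 2 * pi / (n%:R * K%:R) :> R.
  by rewrite natrM; field; rewrite !gt_eqF.
suff : 2 * pi / (n%:R * K%:R) <= e by rewrite /e; lra.
move: xK; rewrite /x ltr_pdivrMr ?mulr_gt0// => xK.
rewrite ler_pdivrMr ?mulr_gt0//; apply: ltW.
by rewrite (_ : e * _ = K%:R * (n%:R * e))//; ring.
Qed.

(** The lower bound uses forms of degree [2 * l - 1], the upper one forms of degree
[2 * l + 1]. *)
Lemma c_circle (R : realType) (l k : nat) : (1 <= l)%N ->
  (2 * l <= k <= 2 * l + 1)%N ->
  c R 1 k = (2 * pi * l%:R) / (2 * l%:R + 1).
Proof.
move=> l1 /andP[lk kl]; set L := RHS.
have l0 : 0 < l%:R :> R by rewrite ltr0n.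
have dn0 : 0 < 2 * l%:R + 1 :> R by rewrite addr_gt0// mulr_gt0.
have L0 : 0 <= L by rewrite divr_ge0 ?mulr_ge0 ?pi_ge0// ltW.
rewrite /c; set S := mkset _.
have lb : lbound S L.
  move=> r [_ [f fo]].
  have m0 : (0 < 2 * l)%N by rewrite muln_gt0.
  have := @odd_map_lower_bound R (2 * l).-1 k r f; rewrite prednK//.
  have -> : odd (2 * l).-1.
    by rewrite -[odd _]negbK -oddS prednK// mul2n odd_double.
  move=> /(_ isT lk fo); apply: le_trans.
  rewrite /L -natr1 natrM le_eqVlt; apply/orP; left; apply/eqP; field.
  by rewrite gt_eqF.
have inS r : L < r -> S r.
  move=> Lr; split; first exact: le_trans (ltW Lr).
  apply: (@ex_odd_map_circle R (2 * l + 1)) => //.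
    by rewrite addn1 /= mul2n odd_double.
  apply: le_lt_trans Lr; rewrite natrD natrM /L le_eqVlt; apply/orP; left.
  by apply/eqP; field; rewrite gt_eqF.
have S0 : S !=set0 by exists (L + 1); apply: inS; rewrite ltrDl.
apply/le_anti/andP; split; last exact: lb_le_inf.
apply/ler_addgt0Pr => e e0; apply: ge_inf; first by exists L.
by apply: inS; rewrite ltrDl.
Qed.

Theorem theorem5p1 (R : realType) (l : nat) (hl : (1 <= l)%N) :
  c R 1 (2 * l + 1) = c R 1 (2 * l) /\
  c R 1 (2 * l) = (2 * pi * l%:R) / (2 * l%:R + 1).
Proof.
by rewrite (@c_circle R l (2 * l + 1)) ?(@c_circle R l (2 * l)) ?leqnn ?leq_addr.
Qed.
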